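(* Let $p\in(1,\infty)$, $\frac1p+\frac1{p^*}=1$, let $\omega>0$ and $q\ge1$ an integer be fixed, and for each $s\in\mathbb{N}$ consider the finite order weights \[ \gamma_{\mathfrak{u}}=\begin{cases}\omega^{|\mathfrak{u}|}&\text{if }|\mathfrak{u}|\le q,\\0&\text{if }|\mathfrak{u}|>q,\end{cases}\qquad \mathfrak{u}\subseteq[s]. \] Let $\imath:F_{s,p,\boldsymbol{\gamma}}\hookrightarrow H_{s,p,\boldsymbol{\gamma}}$, $\imath(f)=f$, be the embedding of the anchored space into the ANOVA space. Then, as $s\to\infty$, \[ \|\imath\|_{F_{s,p,\boldsymbol{\gamma}}\hookrightarrow H_{s,p,\boldsymbol{\gamma}}}=\Theta\left(s^{q/p^*}\right), \] with implied constants independent of $s$.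
   Context: Notation: $[s]=\{1,\dots,s\}$, $D=[0,1]$, $D^{\mathfrak{u}}=D^{|\mathfrak{u}|}$ with coordinates indexed by $\mathfrak{u}\subseteq[s]$, $\mathfrak{u}^c=[s]\setminus\mathfrak{u}$, $\boldsymbol{x}_{\mathfrak{u}}=(x_j)_{j\in\mathfrak{u}}$; $[\boldsymbol{x}_{\mathfrak{u}};\boldsymbol{t}_{\mathfrak{u}^c}]$ has entries $x_j$ for $j\in\mathfrak{u}$ and $t_j$ for $j\notin\mathfrak{u}$. $f^{(\mathfrak{u})}=\prod_{j\in\mathfrak{u}}\frac{\partial}{\partial x_j}f$, $f^{(\emptyset)}=f$. $\boldsymbol{1}_I$ is the characteristic function of $I$. All functions are real-valued. $L_p(D^\emptyset)$ is identified with $\mathbb{R}$ with the absolute value as norm. $\mathfrak{U}=\{\mathfrak{u}\subseteq[s]:\gamma_{\mathfrak{u}}>0\}$. Anchored space: $F_{s,p,\boldsymbol{\gamma}}$ is the space of functions on $D^s$ of the form $f=\sum_{\mathfrak{u}\in\mathfrak{U}}f_{\mathfrak{u}}$ with $f_{\mathfrak{u}}(\boldsymbol{x})=\int_{D^{\mathfrak{u}}}h_{\mathfrak{u}}(\boldsymbol{t}_{\mathfrak{u}})\prod_{j\in\mathfrak{u}}\boldsymbol{1}_{[0,x_j)}(t_j)\,\mathrm{d}\boldsymbol{t}_{\mathfrak{u}}$, $h_{\mathfrak{u}}\in L_p(D^{\mathfrak{u}})$ ($f_\emptyset$ is a constant). This decomposition is unique, $h_{\mathfrak{u}}=f^{(\mathfrak{u})}([\cdot_{\mathfrak{u}};\boldsymbol{0}_{\mathfrak{u}^c}])$,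 and the norm is $\|f\|_{F_{s,p,\boldsymbol{\gamma}}}=\big(\sum_{\mathfrak{u}\in\mathfrak{U}}\gamma_{\mathfrak{u}}^{-p}\|h_{\mathfrak{u}}\|_{L_p(D^{\mathfrak{u}})}^p\big)^{1/p}$. ANOVA space: $H_{s,p,\boldsymbol{\gamma}}$ is the space of functions of the form $f=\sum_{\mathfrak{u}\in\mathfrak{U}}f_{\mathfrak{u}}$ with $f_{\mathfrak{u}}(\boldsymbol{x})=\int_{D^{\mathfrak{u}}}g_{\mathfrak{u}}(\boldsymbol{t}_{\mathfrak{u}})\prod_{j\in\mathfrak{u}}(\boldsymbol{1}_{[0,x_j)}(t_j)-(1-t_j))\,\mathrm{d}\boldsymbol{t}_{\mathfrak{u}}$, $g_{\mathfrak{u}}\in L_p(D^{\mathfrak{u}})$. This decomposition is unique, $g_{\mathfrak{u}}=\int_{D^{\mathfrak{u}^c}}f^{(\mathfrak{u})}([\cdot_{\mathfrak{u}};\boldsymbol{t}_{\mathfrak{u}^c}])\,\mathrm{d}\boldsymbol{t}_{\mathfrak{u}^c}$, and the norm is $\|f\|_{H_{s,p,\boldsymbol{\gamma}}}=\big(\sum_{\mathfrak{u}\in\mathfrak{U}}\gamma_{\mathfrak{u}}^{-p}\|g_{\mathfrak{u}}\|_{L_p(D^{\mathfrak{u}})}^p\big)^{1/p}$. For these weights the two spaces are equal as sets of functions, so $\imath$ is well defined; $\|\imath\|$ is its operator norm. $a_s=\Theta(b_s)$ means that there are constants $0<c_1\le c_2<\infty$ (which may depend on $p,q,\omega$ but not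 on $s$) with $c_1b_s\le a_s\le c_2b_s$ for all sufficiently large $s$. *)

(* Defs.v *)
From HB Require Import structures.
From mathcomp Require Import all_boot all_order all_algebra.
From mathcomp Require Import all_classical all_reals all_analysis.
Import Order.TTheory GRing.Theory Num.Theory.
Import numFieldNormedType.Exports.

Set Implicit Arguments.
Unset Strict Implicit.
Unset Printing Implicit Defensive.

Local Open Scope classical_set_scope.
Local Open Scope ring_scope.

Section lebesgue_cube.
Context {R : realType}.

Definition unit_interval : set (measurableTypeR R) := `[0, 1]%classic.

Lemma measurable_unit_interval : measurable unit_interval.
Proof. exact: measurable_itv. Qed.

Definition lebesgue01 : set (measurableTypeR R) -> \bar R :=
  mrestr lebesgue_measure measurable_unit_interval.

HB.instance Definition _ := Measure.on lebesgue01.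

Let lebesgue01_setT : lebesgue01 [set: measurableTypeR R] = 1%E.
Proof.
by rewrite /lebesgue01 /mrestr setTI lebesgue_measure_itv /= lte01 oppr0 adde0.
Qed.

HB.instance Definition _ :=
  @Measure_isProbability.Build _ _ R lebesgue01 lebesgue01_setT.

Definition cons_tuple n (xt : measurableTypeR R * n.-tuple (measurableTypeR R)) :
  n.+1.-tuple (measurableTypeR R) := [tuple of xt.1 :: xt.2].

Lemma measurable_cons_tuple n : measurable_fun setT (@cons_tuple n).
Proof. exact: measurable_cons. Qed.

HB.instance Definition _ n :=
  isMeasurableFun.Build _ _ _ _ (@cons_tuple n) (@measurable_cons_tuple n).

(* Lebesgue measure on D^n = [0, 1]^n, carried by the space R^n of n-tuples and
   vanishing outside D^n, so that L_p(D^n) is [Lfun (lebesgue_cube n) p%:E].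
   For n = 0 it is the unit mass on the one-point space, so that L_p(D^0) is R
   with the absolute value. *)
Fixpoint lebesgue_cube n : probability (n.-tuple (measurableTypeR R)) R :=
  if n is n'.+1
  then distribution (lebesgue01 \x lebesgue_cube n')%E (@cons_tuple n')
  else dirac [tuple].

End lebesgue_cube.

Section function_spaces.
Context {R : realType}.

(* For u included in [s], a function on D^u is a function of #|u| variables,
   the i-th of which is the coordinate [enum_val i] of u, i < #|u|. *)
Definition family s :=
  forall u : {set 'I_s}, #|u|.-tuple (measurableTypeR R) -> R.

Definition anchored_kernel (x t : R) : R := \1_`[0, x[%classic t.

Definition anova_kernel (x t : R) : R := \1_`[0, x[%classic t - (1 - t).

Definition component (k : R -> R -> R) s (u : {set 'I_s})
    (h : #|u|.-tuple (measurableTypeR R) -> R) (x : s.-tuple R) : R :=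
  (\int[lebesgue_cube #|u|]_t
     (h t * \prod_(i < #|u|) k (tnth x (enum_val i)) (tnth t i)))%R.

(* [h] gives the decomposition of the restriction of [f] to D^s; only the
   [h u] with [0 < gam u] matter. *)
Definition decomposition (k : R -> R -> R) s (gam : {set 'I_s} -> R) (p : R)
    (f : s.-tuple R -> R) (h : family s) : Prop :=
  (forall u, 0 < gam u -> h u \in Lfun (lebesgue_cube #|u|) p%:E) /\
  (forall x : s.-tuple R, (forall j, 0 <= tnth x j <= 1) ->
     f x = \sum_(u : {set 'I_s} | 0 < gam u) component k (h u) x).

Definition weighted_norm s (gam : {set 'I_s} -> R) (p : R) (h : family s) :
    \bar R :=
  ((\sum_(u : {set 'I_s} | (0 < gam u)%R)
      (gam u `^ (- p))%R%:E
      * Lnorm (lebesgue_cube #|u|) p%:E (EFin \o h u) `^ p) `^ p^-1)%E.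

Definition space (k : R -> R -> R) s (gam : {set 'I_s} -> R) (p : R) :
    set (s.-tuple R -> R) :=
  [set f | exists h, decomposition k gam p f h].

(* The norm given by the decomposition of [f], which is unique for both kernels
   up to almost everywhere equality; it is +oo outside of the space. *)
Definition space_norm (k : R -> R -> R) s (gam : {set 'I_s} -> R) (p : R)
    (f : s.-tuple R -> R) : \bar R :=
  xget +oo%E
    [set N | exists2 h, decomposition k gam p f h & N = weighted_norm gam p h].

Definition anchored_space := space anchored_kernel.
Definition anchored_norm := space_norm anchored_kernel.
Definition anova_space := space anova_kernel.
Definition anova_norm := space_norm anova_kernel.

(* A finite value forces the anchored space to be included in the ANOVA
   space. *)
Definition embedding_norm s (gam : {set 'I_s} -> R) (p : R) : \bar R :=
  ereal_sup [set anova_norm gam p f |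
    f in [set f | anchored_space gam p f /\ (anchored_norm gam p f <= 1)%E]].

Definition finite_order_weight (omega : R) (q : nat) s (u : {set 'I_s}) : R :=
  if (#|u| <= q)%N then omega ^+ #|u| else 0.

Definition is_Theta (a : nat -> \bar R) (b : nat -> R) : Prop :=
  exists c1 c2 : R, [/\ 0 < c1, c1 <= c2 &
    \forall s \near \oo, ((c1 * b s)%:E <= a s <= (c2 * b s)%:E)%E].

End function_spaces.

(* Main.v *)
(* Since 1_[0,x)(t) = (1_[0,x)(t) - (1 - t)) + (1 - t), expanding the product
   over u turns an anchored decomposition h into the ANOVA decomposition
     g_v(t_v) = \sum_(u >= v) \int h_u(t_u) \prod_(j in u \ v) (1 - t_j) dt_(u \ v),
   and replacing 1 - t by -(1 - t) gives the converse. The anchored decomposition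
   is unique: setting x_j = 0 off u isolates the components indexed by subsets
   of u, and a function whose integrals over the boxes [0, x) all vanish is zero.
   The ANOVA decomposition is unique because the conversion is triangular.
   Upper bound: by Jensen's inequality each summand of g_v is bounded in L_p by
   h_u, and Hoelder's inequality for a sum of at most (s + 1)^q terms gives the
   factor s^(q / p^* ).
   Lower bound: take h_u equal to one constant for all |u| = q; then
   |g_{emptyset}| is already of order 'C(s, q) times this constant. *)
Require Import Defs.
From mathcomp Require Import all_boot all_order all_algebra.
From mathcomp Require Import all_classical all_reals all_analysis.
From mathcomp Require Import measurable_realfun ring lra.
Import Order.TTheory GRing.Theory Num.Theory.
Import numFieldNormedType.Exports.

Set Implicit Arguments.
Unset Strict Implicit.
Unset Printing Implicit Defensive.

Local Open Scope classical_set_scope.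
Local Open Scope ring_scope.

(** * The Lebesgue measure on the cube *)

Section boxes.
Context d (T : measurableType d).
Implicit Types (E : set (set T)) (n : nat).

Definition box n (A : 'I_n -> set T) : set (n.-tuple T) :=
  [set t | forall i, A i (tnth t i)].

Definition boxes n E : set (set (n.-tuple T)) :=
  [set box A | A in [set A : 'I_n -> set T | forall i, E (A i)]].

Lemma measurable_box n (A : 'I_n -> set T) :
  (forall i, measurable (A i)) -> measurable (box A).
Proof.
move=> mA; rewrite (_ : box A = \bigcap_(i in setT) ((@tnth n T)^~ i @^-1` A i)).
  apply: fin_bigcap_measurable => // i _; rewrite -[X in measurable X]setTI.
  exact: measurable_tnth.
by apply/seteqP; split=> [t At i _|t At i]; [exact: At|exact: At].
Qed.

Lemma setI_closed_boxes n E : setI_closed E -> setI_closed (@boxes n E).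
Proof.
move=> EI _ _ [A EA <-] [B EB <-]; exists (fun i => A i `&` B i).
  by move=> i; exact: EI.
apply/seteqP; split=> [t AB|t [At Bt] i]; last by split.
by split=> i; have [] := AB i.
Qed.

(** Because [E] contains [setT], a cylinder over one set of [E] is a box. The sets whose cylinders
    lie in the generated sigma-algebra then form a sigma-algebra containing [E], hence exhaust the
    measurable sets. *)
Lemma measurable_tuple_boxes n E : E setT -> @measurable _ T = <<s E >> ->
  @measurable _ (n.-tuple T) = <<s @boxes n E >>.
Proof.
move=> ET mE; apply/seteqP; split; last first.
  apply: smallest_sub; first exact: sigma_algebra_measurable.
  move=> _ [A EA <-]; apply: measurable_box => i; rewrite mE.
  exact: sub_sigma_algebra.
apply: smallest_sub; first exact: smallest_sigma_algebra.
rewrite -bigcup_seq => B [i /= _].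
case=> Y mY <-; rewrite setTI.
have /(_ _ mY) : @measurable _ T `<=`
    [set Z | <<s @boxes n E >> ((@tnth n T)^~ i @^-1` Z)].
  rewrite mE; apply: smallest_sub.
    split=> /=.
    - by rewrite preimage_set0; exact: sigma_algebra0.
    - by move=> A; rewrite setTD -preimage_setC; exact: sigma_algebraC.
    - by move=> F HF; rewrite preimage_bigcup; exact: sigma_algebra_bigcup.
  move=> A EA /=; apply: sub_sigma_algebra.
  exists (fun j => if j == i then A else setT) => [j|]; first by case: ifP.
  apply/seteqP; split=> t; first by move=> /(_ i); rewrite eqxx.
  by move=> At j; case: eqP => // ->.
by [].
Qed.

End boxes.

Section cube.
Context {R : realType}.
Local Notation MR := (measurableTypeR R).
Local Notation cube := (@lebesgue_cube R).
Local Notation lam := (@lebesgue01 R).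

Lemma lebesgue_cube_box n (A : 'I_n -> set MR) :
  (forall i, measurable (A i)) ->
  (cube n (box A) = \prod_(i < n) lam (A i))%E.
Proof.
elim: n A => [|n IH] A mA.
  rewrite big_ord0 /= diracE mem_set// => i; by case: i.
rewrite big_ord_recl /=.
rewrite /distribution /pushforward.
rewrite (_ : _ @^-1` _ = A ord0 `*` box (fun i => A (lift ord0 i))); last first.
  apply/seteqP; split=> [[a t] /= At|[a t] /= [A0 At] i].
    split; first by have := At ord0.
    by move=> i; have := At (lift ord0 i); rewrite tnthS.
  case: (unliftP ord0 i) => [j ->|-> //]; rewrite tnthS; exact: At.
rewrite product_measure1E//; last exact: measurable_box.
by congr (_ * _)%E; exact: IH.
Qed.

(** Boxes with measurable sides form a pi-system that generates the product sigma-algebra and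
    contains the whole space, which has finite measure. *)
Lemma lebesgue_cube_unique n (nu : {measure set (n.-tuple MR) -> \bar R}) :
  (forall A : 'I_n -> set MR, (forall i, measurable (A i)) ->
    nu (box A) = \prod_(i < n) lam (A i))%E ->
  forall X, measurable X -> nu X = cube n X.
Proof.
move=> nuE X mX.
have nuB B : boxes measurable B -> nu B = cube n B.
  by case=> A mA <-; rewrite nuE// lebesgue_cube_box.
have bT : @boxes _ MR n measurable setT.
  exists (fun=> setT) => [i|]; first exact: measurableT.
  by apply/seteqP; split.
apply: (measure_unique (boxes measurable) (fun=> setT)) => //.
- apply: measurable_tuple_boxes => //.
  by rewrite sigma_algebra_id//; exact: sigma_algebra_measurable.
- by apply: setI_closed_boxes => A B; exact: measurableI.
- by apply/seteqP; split=> // t _; exists 0%N.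
- by move=> _; rewrite nuB// probability_setT ltry.
Qed.

(** One map covers every rearrangement of coordinates needed below: places that [sg] does not hit
    are simply dropped. *)
Definition select n a b (sg : 'I_n -> 'I_a + 'I_b)
    (z : a.-tuple MR * b.-tuple MR) : n.-tuple MR :=
  [tuple match sg i with inl j => tnth z.1 j | inr j => tnth z.2 j end | i < n].

Lemma measurable_select n a b (sg : 'I_n -> 'I_a + 'I_b) :
  measurable_fun setT (select sg).
Proof.
apply/measurable_fun_tnthP => i.
rewrite (_ : _ \o _ = fun z => match sg i with
  inl j => tnth z.1 j | inr j => tnth z.2 j end); last first.
  by apply/funext => z /=; rewrite tnth_mktuple.
case: (sg i) => j; apply: (measurableT_comp (measurable_tnth _)) => //.
Qed.

(** Coordinates read from distinct places are independent and uniform on $[0,1]$, and unread ones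
    have total mass 1. By uniqueness only boxes need checking, and their preimages are products of
    boxes. *)
Lemma lebesgue_cube_select n a b (sg : 'I_n -> 'I_a + 'I_b) :
  injective sg -> forall X, measurable X ->
  pushforward (cube a \x cube b)%E (select sg) X = cube n X.
Proof.
move=> sgI; apply: lebesgue_cube_unique => [|_ A mA /=]; first exact: measurable_select.
(* The side of the preimage at the place [z]: injectivity leaves at most one [i] with [sg i = z],
   and without such an [i] the side is the whole line, of measure 1. *)
pose D z := \bigcap_(i in [set i | sg i = z]) A i.
have mD z : measurable (D z).
  by apply: fin_bigcap_measurable => [|i _]; [exact: finite_finset|exact: mA].
have lamD z : (lam (D z) = \prod_(i < n | sg i == z) lam (A i))%E.
  rewrite /D; have [[i iz]|nz] := pselect (exists i, sg i = z).
    rewrite (big_pred1 i) => [|j]; last by rewrite -iz; apply/eqP/eqP => [/sgI|->].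
    rewrite (_ : [set _ | _] = [set i]) ?bigcap_set1//.
    by apply/seteqP; split=> [j /=|j ->//]; rewrite -iz => /sgI.
  rewrite big_pred0 => [|j]; last by apply/eqP => jz; apply: nz; exists j.
  rewrite (_ : [set _ | _] = set0) ?bigcap_set0 ?probability_setT//.
  by apply/seteqP; split=> // j jz; case: nz; exists j.
rewrite /pushforward (_ : _ @^-1` _ =
    box (fun j => D (inl j)) `*` box (fun j => D (inr j))); last first.
  apply/seteqP; split=> [[t y] /= At|[t y] /= [At Ay] i].
    by split=> j i /= ij; have := At i; rewrite /= tnth_mktuple ij.
  rewrite tnth_mktuple; case E: (sg i) => [j|j]; [exact: At|exact: Ay].
rewrite product_measure1E; [|exact: measurable_box|exact: measurable_box].
transitivity ((\prod_(j < a) lam (D (inl j))) * \prod_(j < b) lam (D (inr j)))%E.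
  by congr (_ * _)%E; exact: lebesgue_cube_box.
rewrite (partition_big sg xpredT)//= big_sumType /=.
by congr (_ * _)%E; apply: eq_bigr => j _; rewrite lamD.
Qed.

End cube.

(** * Fubini's theorem for real-valued integrals *)

Section Rintegral_fubini.
Context d1 d2 (T1 : measurableType d1) (T2 : measurableType d2) {R : realType}.
Variables (m1 : {sigma_finite_measure set T1 -> \bar R}).
Variables (m2 : {sigma_finite_measure set T2 -> \bar R}).
Variable f : T1 * T2 -> R.
Hypothesis fi : (m1 \x m2)%E.-integrable setT (EFin \o f).

(** [fine] changes the inner integral only where it is infinite, which is a null set because [f] is
    integrable. *)
Let ae_fineE : ae_eq m1 setT (fun x => (\int[m2]_y f (x, y))%:E)
  (fubini_F m2 (EFin \o f)).
Proof.
have := integrable_ae measurableT (integrable_fubini_F fi).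
by apply: filterS => x /= /(_ I) fx _; rewrite /Rintegral fineK.
Qed.

Lemma measurable_Rintegral_fubini :
  measurable_fun setT (fun x => \int[m2]_y f (x, y)).
Proof.
have mfine := @fine_measurable R setT measurableT.
exact: (measurableT_comp mfine (measurable_fubini_F fi)).
Qed.

(** [fine] sends infinite values to 0, so it never increases the absolute value of the inner
    integral. *)
Lemma integrable_Rintegral_fubini :
  m1.-integrable setT (fun x => (\int[m2]_y f (x, y))%:E).
Proof.
have Fi := integrable_fubini_F fi.
apply: (le_integrable _ _ _ Fi) => //.
  by apply/measurable_EFinP; exact: measurable_Rintegral_fubini.
move=> x _ /=; rewrite /Rintegral /fubini_F /=.
by case: (integral _ _ _) => //= ; rewrite normr0 leey.
Qed.

Lemma Rintegral_fubini :
  \int[(m1 \x m2)%E]_z f z = \int[m1]_x \int[m2]_y f (x, y).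
Proof.
rewrite /Rintegral -integral12_prod_meas1//; congr fine.
apply/esym/ae_eq_integral => //.
- by apply/measurable_EFinP; exact: measurable_Rintegral_fubini.
- exact: (measurable_fubini_F fi).
Qed.

End Rintegral_fubini.

(** * Change of variables along [select] *)

Section select_integral.
Context {R : realType}.
Local Notation MR := (measurableTypeR R).
Local Notation cube := (@lebesgue_cube R).
Variables (n a b : nat) (sg : 'I_n -> 'I_a + 'I_b).
Hypothesis sgI : injective sg.
Implicit Types f : n.-tuple MR -> R.

Lemma ge0_integral_select (f : n.-tuple MR -> \bar R) :
  measurable_fun setT f -> (forall t, 0 <= f t)%E ->
  (\int[cube n]_t f t = \int[cube a]_t \int[cube b]_y f (select sg (t, y)))%E.
Proof.
move=> mf f0; have mS := @measurable_select R _ _ _ sg.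
transitivity (\int[pushforward (cube a \x cube b)%E (select sg)]_t f t)%E.
  apply: eq_measure_integral => // X mX _; exact/esym/(lebesgue_cube_select sgI mX).
rewrite ge0_integral_pushforward// fubini_tonelli1//.
  exact: measurableT_comp mf mS.
by move=> z; exact: f0.
Qed.

Lemma integrable_select f : (cube n).-integrable setT (EFin \o f) ->
  (cube a \x cube b)%E.-integrable setT (EFin \o (f \o select sg)).
Proof.
move=> /integrableP[mf fi]; have mS := @measurable_select R _ _ _ sg.
apply/integrableP; split; first exact: measurableT_comp mf mS.
rewrite ge0_integral_select// in fi; last exact: measurableT_comp.
rewrite fubini_tonelli1//; apply: measurableT_comp => //.
exact: measurableT_comp mf mS.
Qed.

Lemma Rintegral_select f : (cube n).-integrable setT (EFin \o f) ->
  \int[cube n]_t f t = \int[cube a]_t \int[cube b]_y f (select sg (t, y)).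
Proof.
move=> fi; have mS := @measurable_select R _ _ _ sg.
rewrite -(Rintegral_fubini (f := f \o select sg)); last exact: integrable_select.
rewrite /Rintegral; congr fine.
transitivity (\int[pushforward (cube a \x cube b)%E (select sg)]_t (f t)%:E)%E.
  apply: eq_measure_integral => // X mX _; exact/esym/(lebesgue_cube_select sgI mX).
rewrite integral_pushforward//; first exact: measurable_int fi.
exact: integrable_select.
Qed.

End select_integral.

Section jensen.
Context d (T : measurableType d) {R : realType} (P : probability T R).

(** Jensen's inequality for the power [p], obtained from Hoelder's inequality against the constant
    1, whose norm is 1 for a probability measure. *)
Lemma poweR_integral_le (f : T -> R) (p q : R) :
  measurable_fun setT f -> 0 < p -> 0 < q -> p^-1 + q^-1 = 1 ->
  ((\int[P]_x `|f x|%:E) `^ p <= \int[P]_x (`|f x| `^ p)%:E)%E.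
Proof.
move=> mf p0 q0 pq.
have := hoelder P mf (@measurable_cst _ _ T (measurableTypeR R) setT 1%R) p0 q0 pq.
have -> : 'N[P]_q%:E[EFin \o cst 1%R]%E = 1%E.
  rewrite Lnorm_cst1 -[RHS](poweR1r q^-1); congr (_ `^ _)%E.
  exact: probability_setT.
rewrite mule1 Lnorm1.
under eq_integral do rewrite /= mulr1.
move=> h; rewrite -[leRHS](@eq_integral _ _ _ _ _ _ (fun x => `|(EFin \o f) x| `^ p)%E)//.
rewrite -poweR_Lnorm ?gt_eqF//.
apply: gt0_ler_poweR; rewrite ?in_itv/= ?leey ?andbT ?(ltW p0)//.
  exact: integral_ge0.
exact: Lnorm_ge0.
Qed.
End jensen.

(** * Gluing coordinates *)

Lemma Rintegral_sum d (T : measurableType d) {R : realType}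
    (m : {measure set T -> \bar R}) (I : Type) (r : seq I) (P : pred I)
    (f : I -> T -> R) :
  (forall i, P i -> m.-integrable setT (EFin \o f i)) ->
  \int[m]_x (\sum_(i <- r | P i) f i x) = \sum_(i <- r | P i) \int[m]_x f i x.
Proof.
move=> fi; have sumi s : m.-integrable setT (EFin \o (fun x => \sum_(i <- s | P i) f i x)).
  rewrite (_ : _ \o _ = fun x => (\sum_(i <- s | P i) (f i x)%:E)%E).
    exact: integrable_sum.
  by apply/funext => x /=; rewrite sumEFin.
elim: r => [|i r IH].
  under eq_Rintegral do rewrite big_nil.
  by rewrite big_nil Rintegral_cst// mul0r.
rewrite big_cons; under eq_Rintegral do rewrite big_cons.
case: ifPn => Pi //; rewrite RintegralD//; first by rewrite IH.
exact: fi.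
Qed.

Lemma integrable_mul_le1 d (T : measurableType d) {R : realType}
    (m : {measure set T -> \bar R}) (h g : T -> R) :
  m.-integrable setT (EFin \o h) -> measurable_fun setT g ->
  (forall t, `|g t| <= 1) -> m.-integrable setT (EFin \o (fun t => h t * g t)).
Proof.
move=> hi mg g1; have /measurable_EFinP mh := measurable_int _ hi.
apply: (le_integrable _ _ _ hi) => //.
  by apply/measurable_EFinP; exact: measurable_funM.
by move=> t _ /=; rewrite lee_fin normrM ler_piMr.
Qed.

Lemma normr_prod_le1 {R : realType} (I : Type) (r : seq I) (P : pred I) (f : I -> R) :
  (forall i, P i -> `|f i| <= 1) -> `|\prod_(i <- r | P i) f i| <= 1.
Proof.
move=> f1; rewrite normr_prod.
have : 0 <= \prod_(i <- r | P i) `|f i| <= 1; last by case/andP.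
elim/big_ind : _.
- by rewrite ler01 lexx.
- by move=> y z /andP[y0 y1] /andP[z0 z1]; rewrite mulr_ge0// mulr_ile1.
- by move=> i Pi; rewrite normr_ge0 f1.
Qed.

Lemma prod_setD_distr {R : comNzRingType} (I : finType) (u : {set I}) (f g : I -> R) :
  \prod_(j in u) (f j + g j) =
  \sum_(v : {set I} | v \subset u) (\prod_(j in v) f j * \prod_(j in u :\: v) g j).
Proof.
(* [F] is 0 and [G] is 1 outside [u], so the product may run over all of [I]; distributivity then
   applies and the terms with [v] not inside [u] vanish. *)
pose F j := if j \in u then f j else 0.
pose G j := if j \in u then g j else 1.
transitivity (\prod_j (F j + G j)).
  rewrite [LHS]big_mkcond; apply: eq_bigr => j _.
  by rewrite /F /G; case: ifP; rewrite ?add0r.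
rewrite bigA_distr (bigID (fun v : {set I} => v \subset u)) /= addrC big1 ?add0r.
  apply: eq_bigr => v vu; rewrite (bigID [in v]) /=; congr (_ * _).
    apply: eq_bigr => j jv; rewrite jv /F; case: ifPn => // /negP[].
    exact: (fintype.subsetP vu).
  rewrite big_mkcond [RHS]big_mkcond; apply: eq_bigr => j _ /=.
  by rewrite inE /G; case: (j \in v).
move=> v /subsetPn[j jv ju]; rewrite (bigD1 j)//= jv /F (negbTE ju).
by rewrite mul0r.
Qed.

Section coordinates.
Context {R : realType}.
Local Notation MR := (measurableTypeR R).
Local Notation cube := (@lebesgue_cube R).
Variable s : nat.
Implicit Types u v : {set 'I_s}.

(** Indexing by ['I_s] instead of a position in [u] lets products over different subsets be
    compared; the value 0 outside [u] is a dummy. *)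
Definition coord u (w : #|u|.-tuple MR) (j : 'I_s) : R :=
  nth (0 : R) w (index j (enum u)).

Lemma coord_enum_val u (w : #|u|.-tuple MR) i : coord w (enum_val i) = tnth w i.
Proof.
rewrite /coord (tnth_nth 0) /enum_val index_uniq ?enum_uniq//.
by rewrite -cardE.
Qed.

Lemma measurable_coord u j : measurable_fun setT (@coord u ^~ j).
Proof.
rewrite /coord; move: (index _ _) => k; have [ku|uk] := ltnP k #|u|.
  rewrite (_ : (fun _ => _) = (@tnth _ MR) ^~ (Ordinal ku)).
    exact: measurable_tnth.
  by apply/funext => w; rewrite (tnth_nth 0).
rewrite (_ : (fun _ => _) = cst 0); first exact: measurable_cst.
by apply/funext => w; rewrite nth_default// size_tuple.
Qed.

(** The second source is a full vector of $s$ coordinates, so that its dimension depends on neither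
    [u] nor [v]; the surplus coordinates integrate to 1. *)
Definition glue_index u v (i : 'I_#|u|) : 'I_#|v| + 'I_s :=
  if insub (index (enum_val i) (enum v)) is Some k then inl k
  else inr (enum_val i).

Lemma glue_index_inj u v : injective (@glue_index u v).
Proof.
move=> i i'; rewrite /glue_index.
case: insubP => [k kv ki|_]; case: insubP => [k' kv' ki'|_] //.
  move=> [kk']; apply: enum_val_inj; apply: (@index_inj _ (enum_val i) (enum v)).
  - by rewrite -index_mem -cardE.
  - by rewrite -index_mem -cardE.
  - by rewrite -ki -ki' kk'.
by move=> [/enum_val_inj].
Qed.

(* The coordinates of [u] that lie in [v] come from [z.1], those outside [v]
   from the full vector [z.2]. *)
Definition glue u v : #|v|.-tuple MR * s.-tuple MR -> #|u|.-tuple MR :=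
  select (@glue_index u v).
Arguments glue : clear implicits.

Lemma coord_glue u v t y j : j \in u ->
  coord (glue u v (t, y)) j = if j \in v then coord t j else tnth y j.
Proof.
move=> ju; rewrite -(enum_rankK_in ju ju); set i := enum_rank_in _ _.
rewrite coord_enum_val tnth_mktuple /glue_index.
have vE : (index (enum_val i) (enum v) < #|v|)%N = (enum_val i \in v).
  by rewrite cardE index_mem mem_enum.
case: insubP => [k|]; rewrite vE; last by move=> /negbTE ->.
by move=> -> ki; rewrite /coord -ki (tnth_nth 0).
Qed.

Lemma componentE k u (h : #|u|.-tuple MR -> R) (x : s.-tuple R) :
  component k h x =
  \int[cube #|u|]_t (h t * \prod_(j in u) k (tnth x j) (coord t j)).
Proof.
apply: eq_Rintegral => t _; rewrite [X in _ = _ * X]big_enum_val; congr (_ * _).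
by apply: eq_bigr => i _; rewrite coord_enum_val.
Qed.

(** The contribution of $h_u$ to the new component at $v$: the coordinates in $u\setminus v$ are
    integrated out against [b]. *)
Definition partial_integral (b : R -> R) u v (h : #|u|.-tuple MR -> R)
    (t : #|v|.-tuple MR) : R :=
  \int[cube s]_y (h (glue u v (t, y)) * \prod_(j in u :\: v) b (tnth y j)).
Arguments partial_integral : clear implicits.

End coordinates.
Arguments partial_integral {R s}.
Arguments glue {R s}.

Lemma measurable_prod_in d (T : measurableType d) {R : realType} (I : finType)
    (u : {set I}) (f : I -> T -> R) :
  (forall j, measurable_fun setT (f j)) ->
  measurable_fun setT (fun t => \prod_(j in u) f j t).
Proof.
move=> mf; rewrite (_ : (fun _ => _) = fun t => \prod_(j <- enum u) f j t).
  by apply: measurable_prod => j _; exact: mf.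
by apply/funext => t; rewrite big_enum.
Qed.

(** * Properties of partial integrals *)

Section partial_integral.
Context {R : realType}.
Local Notation MR := (measurableTypeR R).
Local Notation cube := (@lebesgue_cube R).
Variables (s : nat) (b : R -> R).
Hypotheses (mb : measurable_fun setT b) (b1 : forall t, `|b t| <= 1).
Variables (u v : {set 'I_s}) (vu : v \subset u) (h : #|u|.-tuple MR -> R).

Let g (z : #|v|.-tuple MR * s.-tuple MR) : R :=
  h (glue u v z) * \prod_(j in u :\: v) b (tnth z.2 j).

Let mprod : measurable_fun setT
  (fun z : #|v|.-tuple MR * s.-tuple MR => \prod_(j in u :\: v) b (tnth z.2 j)).
Proof.
apply: measurable_prod_in => j; apply: (measurableT_comp mb).
exact: (measurableT_comp (measurable_tnth _)).
Qed.

Let prod_le1 (y : s.-tuple MR) : `|\prod_(j in u :\: v) b (tnth y j)| <= 1.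
Proof. by apply: normr_prod_le1 => j _; exact: b1. Qed.

Section integrable.
Hypothesis hi : (cube #|u|).-integrable setT (EFin \o h).

Let gi : (cube #|v| \x cube s)%E.-integrable setT (EFin \o g).
Proof.
apply: integrable_mul_le1 => //.
exact: (integrable_select (@glue_index_inj _ u v) hi).
Qed.

Lemma measurable_partial_integral : measurable_fun setT (partial_integral b u v h).
Proof. exact: measurable_Rintegral_fubini gi. Qed.

Lemma integrable_partial_integral :
  (cube #|v|).-integrable setT (EFin \o partial_integral b u v h).
Proof. exact: integrable_Rintegral_fubini gi. Qed.

(** Fubini in the glued coordinates: the product over [v] depends on the outer variable only and
    leaves the inner integral. *)
Lemma Rintegral_partial_integral (c : 'I_s -> R -> R) :
  (forall j, measurable_fun setT (c j)) -> (forall j t, `|c j t| <= 1) ->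
  \int[cube #|u|]_w (h w * (\prod_(j in v) c j (coord w j) *
    \prod_(j in u :\: v) b (coord w j))) =
  \int[cube #|v|]_t (partial_integral b u v h t * \prod_(j in v) c j (coord t j)).
Proof.
move=> mc c1.
have mcv : measurable_fun setT (fun t : #|v|.-tuple MR => \prod_(j in v) c j (coord t j)).
  by apply: measurable_prod_in => j; apply: measurableT_comp => //; exact: measurable_coord.
have gci : (cube #|v| \x cube s)%E.-integrable setT
    (EFin \o (fun z => g z * \prod_(j in v) c j (coord z.1 j))).
  apply: integrable_mul_le1 => //; first exact: (measurableT_comp mcv).
  by move=> z; apply: normr_prod_le1.
rewrite (Rintegral_select (@glue_index_inj _ u v)); last first.
  apply: integrable_mul_le1 => //.
    by apply: measurable_funM; apply: measurable_prod_in => j;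
      apply: measurableT_comp => //; exact: measurable_coord.
  by move=> t; rewrite normrM mulr_ile1// normr_prod_le1.
transitivity (\int[cube #|v|]_t \int[cube s]_y (g (t, y) * \prod_(j in v) c j (coord t j))).
  apply: eq_Rintegral => t _; apply: eq_Rintegral => y _.
  rewrite /g -mulrA; congr (_ * _); rewrite mulrC; congr (_ * _).
    apply: eq_bigr => j /setDP[ju /negbTE jv].
    by rewrite -/(glue u v) coord_glue// jv.
  apply: eq_bigr => j jv.
  by rewrite -/(glue u v) coord_glue ?jv//; exact: (fintype.subsetP vu).
(* Pulling the factor out uses integrability of the slice, which is available for almost every
   [t]. *)
congr fine; apply: ae_eq_integral => //.
- apply/measurable_EFinP; exact: (measurable_Rintegral_fubini gci).
- by apply/measurable_EFinP; apply: measurable_funM => //; exact: measurable_partial_integral.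
have := ae_integrable1 gi; apply: filterS => t ti _.
by rewrite RintegralZr.
Qed.

(** The product of values of [b] is at most 1 in absolute value and is dropped; Jensen's inequality
    on each slice, followed by Tonelli, gives the bound. *)
Lemma integral_poweR_partial_integral (p q : R) :
  0 < p -> 0 < q -> p^-1 + q^-1 = 1 ->
  (\int[cube #|v|]_t (`|partial_integral b u v h t| `^ p)%:E <=
   \int[cube #|u|]_w (`|h w| `^ p)%:E)%E.
Proof.
move=> p0 q0 pq; have /measurable_EFinP mh := measurable_int _ hi.
have mhg : measurable_fun setT (h \o glue u v).
  by apply: measurableT_comp => //; exact: measurable_select.
have mpow : measurable_fun setT (fun w => (`|h w| `^ p)%:E).
  apply/measurable_EFinP/(measurableT_comp (measurable_powR p)).
  exact: measurableT_comp.
have mhgt t : measurable_fun setT (fun y => h (glue u v (t, y))).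
  exact: (measurableT_comp mhg (pair1_measurable t)).
have mpt (t : #|v|.-tuple MR) : measurable_fun setT (fun y : s.-tuple MR => \prod_(j in u :\: v) b (tnth y j)).
  exact: (measurableT_comp mprod (pair1_measurable t)).
have mgt t : measurable_fun setT (fun y => g (t, y)).
  exact: (measurable_funM (mhgt t) (mpt t)).
rewrite (ge0_integral_select (@glue_index_inj _ u v))//.
apply: ge0_le_integral => //.
- apply/measurable_EFinP/(measurableT_comp (measurable_powR p)).
  by apply: measurableT_comp => //; exact: measurable_partial_integral.
- apply: (measurable_fun_fubini_tonelli_F (fun z => (`|h (glue u v z)| `^ p)%:E)).
    exact: (measurableT_comp mpow (@measurable_select _ _ _ _ _)).
  by move=> z; rewrite lee_fin powR_ge0.
move=> t _; apply: le_trans (poweR_integral_le (cube s) (mhgt t) p0 q0 pq).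
rewrite -poweR_EFin; apply: gt0_ler_poweR; rewrite ?in_itv/= ?leey ?andbT ?(ltW p0)//.
  exact: integral_ge0.
apply: (@le_trans _ _ `|\int[cube s]_y (g (t, y))%:E|%E).
  (* If the extended integral is infinite, [Rintegral] is 0 and the bound still holds. *)
  by rewrite /partial_integral /Rintegral /g; case: (integral _ _ _) => //=; rewrite normr0 leey.
apply: le_trans (le_abse_integral _ _ _) _ => //.
  exact/measurable_EFinP.
apply: ge0_le_integral => //.
- by apply/measurable_EFinP; exact: measurableT_comp.
- by apply/measurable_EFinP; exact: measurableT_comp.
- by move=> y _; rewrite lee_fin normrM ler_piMr.
Qed.

End integrable.
End partial_integral.

(** Expanding the product over [u] chooses, for each [j], the kernel ([j] in [v]) or [b]; the
    coordinates of the second kind are integrated out. *)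
Lemma component_split {R : realType} s (k : R -> R -> R) (b : R -> R)
  (u : {set 'I_s}) (h : #|u|.-tuple (measurableTypeR R) -> R) (x : s.-tuple R) :
  (forall x, measurable_fun setT (k x)) -> (forall x t, `|k x t| <= 1) ->
  measurable_fun setT b -> (forall t, `|b t| <= 1) ->
  (lebesgue_cube #|u|).-integrable setT (EFin \o h) ->
  component (fun x t => k x t + b t) h x =
  \sum_(v : {set 'I_s} | v \subset u) component k (partial_integral b u v h) x.
Proof.
move=> mk k1 mb b1 hi; rewrite componentE.
under eq_Rintegral do rewrite prod_setD_distr mulr_sumr.
rewrite Rintegral_sum => [|v vu].
  apply: eq_bigr => v vu; rewrite componentE.
  by rewrite (Rintegral_partial_integral mb b1 vu hi (c := fun j => k (tnth x j))).
apply: integrable_mul_le1 => //.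
  by apply: measurable_funM; apply: measurable_prod_in => j;
    apply: measurableT_comp => //; exact: measurable_coord.
by move=> t; rewrite normrM mulr_ile1// normr_prod_le1.
Qed.

(** * Functions determined by their anchored kernel transform *)

Section anchored_vanish.
Context {R : realType}.
Local Notation MR := (measurableTypeR R).
Local Notation cube := (@lebesgue_cube R).

Lemma lebesgue01_itvco (x : R) : 0 <= x <= 1 -> lebesgue01 `[0, x[%classic = x%:E.
Proof.
move=> /andP[x0 x1]; rewrite /lebesgue01 /mrestr setIidl; last first.
  move=> t /=; rewrite /unit_interval/= !in_itv/= => /andP[-> tx] /=.
  by rewrite (le_trans (ltW tx)).
rewrite lebesgue_measure_itv/= lte_fin; case: ltP => x0'; first by rewrite oppr0 adde0.
by congr EFin; apply/le_anti; rewrite x0 x0'.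
Qed.

(** The faces $t_i=1$ are null sets. On $[0,1)$ rays match anchored kernels and [hat], introduced
    below, matches $1-t$. *)
Lemma ae_cube_itvco n :
  {ae cube n, forall t, forall i, `[0, 1[%classic (tnth t i)}.
Proof.
have mB : measurable (box (fun _ : 'I_n => `[0, 1[%classic : set MR)).
  by apply: measurable_box => i; exact: measurable_itv.
exists (~` box (fun _ : 'I_n => `[0, 1[%classic : set MR)); split => //.
- exact: measurableC.
- rewrite probability_setC// lebesgue_cube_box => [|i]; last exact: measurable_itv.
  by rewrite big1 ?subee// => i _; rewrite lebesgue01_itvco// ler01 lexx.
Qed.

Lemma measurable_anchored_kernel x : measurable_fun setT (@anchored_kernel R x).
Proof. exact: measurable_indic. Qed.

Lemma anchored_kernel_le1 (x t : R) : `|anchored_kernel x t| <= 1.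
Proof. by rewrite /anchored_kernel indicE; case: (_ \in _); rewrite ?normr1 ?normr0. Qed.

(* With [setT], boxes of rays include all the cylinders. *)
Definition rays : set (set MR) :=
  [set A | A = setT \/ exists x, A = `]-oo, x[%classic].

Lemma measurable_rays : @measurable _ MR = <<s rays >>.
Proof.
apply/seteqP; split; last first.
  apply: smallest_sub; first exact: sigma_algebra_measurable.
  by move=> _ [->|[x ->]]; [exact: measurableT|exact: measurable_itv].
rewrite [X in X `<=` _]RGenInftyO.measurableE.
apply: smallest_sub; first exact: smallest_sigma_algebra.
by move=> A GA; apply: sub_sigma_algebra; right.
Qed.

Lemma setI_closed_rays : setI_closed rays.
Proof.
move=> _ _ [->|[x ->]] [->|[y ->]]; rewrite ?setTI ?setIT.
- by left.
- by right; exists y.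
- by right; exists x.
- right; exists (Num.min x y); apply/seteqP; split=> t /=; rewrite !in_itv/= lt_min.
    by case=> -> ->.
  by move=> /andP[].
Qed.

(** Truncating the endpoint of a ray to $[0,1]$ leaves its indicator unchanged on $[0,1)$; the whole
    line corresponds to $x=1$. *)
Lemma rays_anchored_kernel A : rays A -> exists2 x : R, 0 <= x <= 1 &
  forall t, `[0, 1[%classic t -> \1_A t = anchored_kernel x t.
Proof.
move=> [->|[x ->]].
  exists 1; rewrite ?ler01 ?lexx// => t t01.
  by rewrite /anchored_kernel !indicE !mem_set.
exists (Num.max 0 (Num.min x 1)).
  by rewrite le_max lexx /= ge_max ler01 ge_min lexx orbT.
move=> t; rewrite /= in_itv/= => /andP[t0 t1].
rewrite /anchored_kernel !indicE; congr (_%:R); congr nat_of_bool.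
apply/idP/idP; rewrite !inE/= !in_itv/= t0 lt_max lt_min t1 ltNge t0 /= andbT //.
Qed.

(** Up to null sets, products of anchored kernels are the indicators of boxes of rays. These boxes
    form a generating pi-system, and the sets over which [h] integrates to 0 form a Dynkin
    system. *)
Lemma anchored_vanish n (h : n.-tuple MR -> R) :
  (cube n).-integrable setT (EFin \o h) ->
  (forall x : n.-tuple R, (forall i, 0 <= tnth x i <= 1) ->
    \int[cube n]_t (h t * \prod_(i < n) anchored_kernel (tnth x i) (tnth t i)) = 0) ->
  ae_eq (cube n) setT h (cst 0).
Proof.
move=> hi h0.
suff H S : measurable S -> (\int[cube n]_(t in S) (h t)%:E = 0)%E.
  have : ae_eq (cube n) setT (EFin \o h) (cst 0%E).
    apply: integral_ae_eq => //.
    by move=> S _ mS; rewrite integral0 H.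
  by apply: filterS => t /= /[apply] -[].
have /measurable_EFinP mh := measurable_int _ hi.
have hS B : measurable B -> (cube n).-integrable B (EFin \o h).
  by move=> mB; apply: integrableS hi.
have mE : @measurable _ (n.-tuple MR) = <<s @boxes _ MR n rays >>.
  by apply: measurable_tuple_boxes; [left|exact: measurable_rays].
have boxP : @boxes _ MR n rays `<=` [set B | (\int[cube n]_(t in B) (h t)%:E = 0)%E].
  move=> _ [A rA <-] /=.
  have mA i : measurable (A i).
    by rewrite measurable_rays; exact: sub_sigma_algebra.
  have /choice[x xP] i : exists x : R, 0 <= x <= 1 /\
     forall t, `[0, 1[%classic t -> \1_(A i) t = anchored_kernel x t.
    by have [x] := rays_anchored_kernel (rA i); exists x.
  pose k (t : n.-tuple MR) := \prod_(i < n) anchored_kernel (x i) (tnth t i).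
  have mk : measurable_fun setT k.
    apply: measurable_prod => i _.
    exact: (measurableT_comp (measurable_anchored_kernel _) (measurable_tnth i)).
  have hki : (cube n).-integrable setT (EFin \o (fun t => h t * k t)).
    apply: integrable_mul_le1 => // t.
    by apply: normr_prod_le1 => i _; exact: anchored_kernel_le1.
  transitivity (\int[cube n]_t (h t * k t)%:E)%E.
    rewrite integral_mkcond; apply: ae_eq_integral => //.
    - apply/measurable_restrict => //; first exact: measurable_box.
      exact: measurable_funS (measurable_int _ hi).
    - exact: measurable_int hki.
    apply: (@filterS _ _ (ae_filter_ringOfSetsType (cube n)) _ _ _ (@ae_cube_itvco n)).
    move=> t t01 _ /=.
    have kE : k t = \prod_(i < n) \1_(A i) (tnth t i).
      by apply: eq_bigr => i _; rewrite (xP i).2//; exact: t01.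
    rewrite patchE kE; case: ifPn => [/set_mem At|At].
      by rewrite big1 ?mulr1// => i _; rewrite indicE mem_set//; exact: At.
    have [i Ai] : exists i, ~ A i (tnth t i).
      by apply/existsNP; apply: contraNnot At => At; apply: mem_set.
    by rewrite (bigD1 i)//= indicE memNset// mul0r mulr0.
  have x01 i : 0 <= tnth [tuple x i | i < n] i <= 1.
    by rewrite tnth_mktuple; exact: (xP i).1.
  have := h0 _ x01; under eq_Rintegral do under eq_bigr do rewrite tnth_mktuple.
  (* A vanishing [Rintegral] alone could hide an infinite integral; integrability excludes this. *)
  rewrite -/k /Rintegral => F0; have := integrable_fin_num measurableT hki.
  by move=> /fineK <-; rewrite F0.
have hC B : measurable B -> (\int[cube n]_(t in B) (h t)%:E = 0 ->
    \int[cube n]_(t in setT) (h t)%:E = 0 ->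
    \int[cube n]_(t in ~` B) (h t)%:E = 0)%E.
  move=> mB B0; rewrite -(setUv B) integral_setU_EFin//.
  - by rewrite B0 add0e.
  - exact: measurableC.
  - by rewrite setUv.
  - by apply/disj_setPCl.
have hT : (\int[cube n]_(t in setT) (h t)%:E = 0)%E.
  apply: boxP; exists (fun=> setT) => [i|]; first by left.
  by apply/seteqP; split.
rewrite mE; apply: (@dynkin_induction _ _ (@boxes _ MR n rays)
  [set B | (\int[cube n]_(t in B) (h t)%:E = 0)%E]) => //.
- by apply: setI_closed_boxes; exact: setI_closed_rays.
- by move=> B mB B0; exact: hC.
- move=> F mF tF F0.
  rewrite /= (integral_bigcup (mu := cube n) (g := EFin \o h)) //.
    by rewrite eseries0 // => i _ _; exact: F0.
  by apply: hS; exact: bigcup_measurable.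
Qed.

End anchored_vanish.

(** * $L_p$ functions and invariance under changes on null sets *)

Section Lp.
Context d (T : measurableType d) {R : realType} (m : {measure set T -> \bar R}).
Variables (p : R) (p1 : 1 < p).

Let p0 : 0 < p. Proof. exact: lt_trans p1. Qed.

Lemma Lnorm_poweRE (h : T -> R) :
  (Lnorm m p%:E (EFin \o h) `^ p = \int[m]_t (`|h t| `^ p)%:E)%E.
Proof. by rewrite poweR_Lnorm ?gt_eqF. Qed.

Lemma Lfun_integralP (h : T -> R) : h \in Lfun m p%:E <->
  measurable_fun setT h /\ (\int[m]_t (`|h t| `^ p)%:E < +oo)%E.
Proof.
split=> [|[mh fh]].
  move=> /andP[]; rewrite !inE /= => mh fh; split => //.
  by rewrite -Lnorm_poweRE; exact: poweR_lty.
apply/andP; rewrite !inE; split => //=; rewrite /finite_norm.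
by apply: (lty_poweRy (r := p)); rewrite ?gt_eqF// Lnorm_poweRE.
Qed.

Lemma Lfun_sum (I : finType) (P : pred I) (h : I -> T -> R) :
  (forall i, P i -> h i \in Lfun m p%:E) ->
  (fun t => \sum_(i | P i) h i t) \in Lfun m p%:E.
Proof.
have p1e : (1 <= p%:E)%E by rewrite lee_fin ltW.
move=> hP; have [S0 SD] := Lfun_addr_closed m p1e.
rewrite (_ : (fun _ => _) = \sum_(i | P i) h i); last by apply/funext => t; rewrite fct_sumE.
by elim/big_ind : _.
Qed.

End Lp.

Lemma Lfun_integrable1 d (T : measurableType d) {R : realType}
    (P : probability T R) (p : R) (h : T -> R) : 1 < p ->
  h \in Lfun P p%:E -> P.-integrable setT (EFin \o h).
Proof.
move=> p1 hL; apply/Lfun1_integrable; apply: Lfun_subset hL => //.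
- by rewrite lee_fin ltW.
- exact: fin_num_measure.
- by rewrite lee_fin ltW.
Qed.

Section ae.
Context {R : realType}.
Local Notation MR := (measurableTypeR R).
Local Notation cube := (@lebesgue_cube R).

(** Agreement of the kernels on $[0,1)$ suffices, since almost every point of the cube has all its
    coordinates there. *)
Lemma component_ae (k k' : R -> R -> R) s (u : {set 'I_s})
    (h h' : #|u|.-tuple MR -> R) (x : s.-tuple R) :
  (forall x, measurable_fun setT (k x)) -> (forall x, measurable_fun setT (k' x)) ->
  (forall x t, 0 <= t < 1 -> k x t = k' x t) ->
  measurable_fun setT h -> measurable_fun setT h' ->
  ae_eq (cube #|u|) setT h h' ->
  component k h x = component k' h' x.
Proof.
move=> mk mk' kk' mh mh' hh'.
have mp (k0 : R -> R -> R) (h0 : #|u|.-tuple MR -> R) :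
    (forall x, measurable_fun setT (k0 x)) -> measurable_fun setT h0 ->
    measurable_fun setT (fun t => (h0 t *
      \prod_(i < #|u|) k0 (tnth x (enum_val i)) (tnth t i))%:E).
  move=> mk0 mh0; apply/measurable_EFinP; apply: measurable_funM => //.
  apply: measurable_prod => i _; exact: (measurableT_comp (mk0 _) (measurable_tnth i)).
rewrite /component /Rintegral; congr fine; apply: ae_eq_integral => //; try exact: mp.
apply: (@filterS2 _ _ (ae_filter_ringOfSetsType (cube #|u|)) _ _ _ _ (@ae_cube_itvco R #|u|) hh').
move=> t t01 /(_ I) -> _; congr (_ * _)%:E; apply: eq_bigr => i _.
by rewrite kk'//; have := t01 i; rewrite /= in_itv.
Qed.

(** By Tonelli the integral of $|h-h'|$ over the glued coordinates is 0, so for almost every [t] the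
    slice of $|h-h'|$ vanishes almost everywhere. *)
Lemma partial_integral_ae s (b : R -> R) (u v : {set 'I_s})
    (h h' : #|u|.-tuple MR -> R) :
  measurable_fun setT b -> measurable_fun setT h -> measurable_fun setT h' ->
  ae_eq (cube #|u|) setT h h' ->
  ae_eq (cube #|v|) setT (partial_integral b u v h) (partial_integral b u v h').
Proof.
move=> mb mh mh' hh'.
pose D w := (`|h w - h' w|)%:E.
have mD : measurable_fun setT D.
  by apply/measurable_EFinP/measurableT_comp => //; exact: measurable_funB.
have D_ge0 w : (0 <= D w)%E by rewrite lee_fin.
have mS := @measurable_select R _ _ _ (@glue_index _ u v).
have mDS : measurable_fun setT (D \o glue u v) by exact: measurableT_comp mD mS.
have D0 : (\int[cube #|v|]_t \int[cube s]_y D (glue u v (t, y)) = 0)%E.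
  rewrite -(ge0_integral_select (@glue_index_inj _ u v))//.
  rewrite (ae_eq_integral (cst 0%E)) ?integral0//.
  by move: hh'; apply: filterS => w /(_ I) hw _; rewrite /D hw subrr normr0.
have F0 : ae_eq (cube #|v|) setT (fubini_F (cube s) (D \o glue u v)) (cst 0%E).
  apply/ae_eq_integral_abs => //.
    exact: (measurable_fun_fubini_tonelli_F (m2 := cube s) _ mDS (fun z => D_ge0 _)).
  rewrite -[RHS]D0; apply: eq_integral => t _; rewrite gee0_abs//.
  by apply: integral_ge0 => y _; exact: D_ge0.
apply: filterS F0 => t /(_ I) Ft _.
have : ae_eq (cube s) setT (fun y => D (glue u v (t, y))) (cst 0%E).
  apply/ae_eq_integral_abs => //; first exact: (measurableT_comp mDS (pair1_measurable t)).
  rewrite -[RHS]Ft; apply: eq_integral => y _; rewrite gee0_abs//; exact: D_ge0.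
move=> Dt; rewrite /partial_integral /Rintegral; congr fine.
have mg (h0 : #|u|.-tuple MR -> R) : measurable_fun setT h0 ->
    measurable_fun setT (fun y : s.-tuple MR => (h0 (glue u v (t, y)) *
      \prod_(j in u :\: v) b (tnth y j))%:E).
  move=> mh0; apply/measurable_EFinP; apply: measurable_funM.
    exact: (measurableT_comp (measurableT_comp mh0 mS) (pair1_measurable t)).
  by apply: measurable_prod_in => j; exact: (measurableT_comp mb (measurable_tnth j)).
apply: ae_eq_integral => //; try exact: mg.
apply: filterS Dt => y /(_ I) /= [] /eqP; rewrite normr_eq0 subr_eq0 => /eqP -> _.
by [].
Qed.
End ae.

(** * Conversion between decompositions and uniqueness *)

Section decompositions.
Context {R : realType}.
Local Notation MR := (measurableTypeR R).
Local Notation cube := (@lebesgue_cube R).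
Variables (s : nat) (gam : {set 'I_s} -> R) (p : R).
Hypothesis p1 : 1 < p.
Hypothesis gam_closed : forall u v : {set 'I_s}, v \subset u -> 0 < gam u -> 0 < gam v.
Implicit Types (u v : {set 'I_s}) (h g : @Defs.family R s).

(** The triangular passage between decompositions for kernels that differ by [b]. With [b] equal to
    [hat] it turns anchored components into ANOVA ones, and with [- hat] it goes back. *)
Definition convert (b : R -> R) h : @Defs.family R s :=
  fun v t => \sum_(u : {set 'I_s} | (v \subset u) && (0 < gam u)) partial_integral b u v (h u) t.
Arguments convert : clear implicits.

Section convert.
Variables (b : R -> R).
Hypotheses (mb : measurable_fun setT b) (b1 : forall t, `|b t| <= 1).

Lemma Lfun_partial_integral u v (h : #|u|.-tuple MR -> R) : v \subset u ->
  h \in Lfun (cube #|u|) p%:E -> partial_integral b u v h \in Lfun (cube #|v|) p%:E.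
Proof.
move=> vu hL; have hi := Lfun_integrable1 p1 hL.
have [_ hfin] := (Lfun_integralP _ p1 _).1 hL.
apply/(Lfun_integralP _ p1); split; first exact: measurable_partial_integral.
apply: le_lt_trans hfin.
have p0 : 0 < p by exact: lt_trans p1.
(* This is the exponent conjugate to [p]. *)
have q0 : 0 < (1 - p^-1)^-1 by rewrite invr_gt0 subr_gt0 invf_lt1.
have pq : p^-1 + (1 - p^-1)^-1^-1 = 1 by rewrite invrK subrKC.
exact: (integral_poweR_partial_integral mb b1 v hi p0 q0 pq).
Qed.

(** Each component splits over the subsets [v] of [u]; exchanging the sums collects the terms at
    [v], whose weight is positive by [gam_closed]. *)
Lemma decomposition_convert (k : R -> R -> R) (f : s.-tuple R -> R) h :
  (forall x, measurable_fun setT (k x)) -> (forall x t, `|k x t| <= 1) ->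
  decomposition (fun x t => k x t + b t) gam p f h ->
  decomposition k gam p f (convert b h).
Proof.
move=> mk k1 [hL fE]; split=> [v gv|x x01].
  by apply: Lfun_sum => // u /andP[vu gu]; apply: Lfun_partial_integral => //; exact: hL.
rewrite fE//.
transitivity (\sum_(u | 0 < gam u) \sum_(v : {set 'I_s} | v \subset u)
    component k (partial_integral b u v (h u)) x).
  apply: eq_bigr => u gu; rewrite component_split//.
  by apply: Lfun_integrable1 p1 _; exact: hL.
rewrite (exchange_big_dep (fun v => 0 < gam v)) /=; last first.
  by move=> u v gu vu; exact: gam_closed gu.
apply: eq_bigr => v gv; rewrite /convert [RHS]componentE.
under [RHS]eq_Rintegral do rewrite mulr_suml.
rewrite Rintegral_sum => [|u /andP[vu gu]].
  rewrite (eq_bigl (fun u => (v \subset u) && (0 < gam u))); last by move=> u; rewrite andbC.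
  by apply: eq_bigr => u _; rewrite componentE.
apply: integrable_mul_le1.
- by apply: integrable_partial_integral => //; apply: Lfun_integrable1 p1 _; exact: hL.
- apply: measurable_prod_in => j; apply: (measurableT_comp (mk _)).
  exact: measurable_coord.
- by move=> t; apply: normr_prod_le1.
Qed.

(** The diagonal of the triangular map is the identity: nothing is left to integrate out, and the
    cube has mass 1. *)
Lemma partial_integral_id v (h : #|v|.-tuple MR -> R) : partial_integral b v v h = h.
Proof.
apply/funext => t; rewrite /partial_integral finset.setDv.
under eq_Rintegral => y _.
  rewrite big_set0 mulr1.
  have -> : glue v v (t, y) = t.
    apply: eq_from_tnth => i; rewrite -coord_enum_val coord_glue ?enum_valP//.
    by rewrite coord_enum_val.
  over.
rewrite Rintegral_cst// -[RHS]mulr1; congr (_ * _).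
exact: (congr1 fine (probability_setT (cube s))).
Qed.

End convert.

(** This lets the ANOVA kernel, unbounded on the real line, be exchanged for a bounded one. *)
Lemma eq_decomposition (k k' : R -> R -> R) f h :
  (forall x, measurable_fun setT (k x)) -> (forall x, measurable_fun setT (k' x)) ->
  (forall x t, 0 <= t < 1 -> k x t = k' x t) ->
  decomposition k gam p f h -> decomposition k' gam p f h.
Proof.
move=> mk mk' kk' [hL fE]; split=> // x x01; rewrite fE//; apply: eq_bigr => u gu.
have [mh _] := (Lfun_integralP _ p1 _).1 (hL u gu).
by apply: component_ae => //; exact: ae_eq_refl.
Qed.

(** Induction on the cardinality of [u]: at a point supported on [u], components at proper subsets
    cancel by the induction hypothesis, and [anchored_vanish] applies to what remains. *)
Lemma anchored_unique f h h' : decomposition (@anchored_kernel R) gam p f h ->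
  decomposition (@anchored_kernel R) gam p f h' ->
  forall u, 0 < gam u -> ae_eq (cube #|u|) setT (h u) (h' u).
Proof.
move=> [hL fE] [hL' fE'].
move=> u; have [n] := ubnP #|u|; elim: n u => // n IH u un gu.
have [hi hi'] := (Lfun_integrable1 p1 (hL u gu), Lfun_integrable1 p1 (hL' u gu)).
suff : ae_eq (cube #|u|) setT (fun t => h u t - h' u t) (cst 0).
  by apply: filterS => t /= /[apply] /eqP; rewrite subr_eq0 => /eqP.
apply: anchored_vanish; first exact: (integrableB measurableT hi hi').
move=> y y01; pose x := [tuple if j \in u then coord y j else 0 | j < s].
have xu i : tnth x (enum_val i) = tnth y i.
  by rewrite tnth_mktuple enum_valP coord_enum_val.
have x01 j : 0 <= tnth x j <= 1.
  have [ju|ju] := boolP (j \in u); last by rewrite tnth_mktuple (negbTE ju) lexx ler01.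
  by rewrite -(enum_rankK_in ju ju) xu.
(* At $x_j=0$ the anchored kernel is the indicator of an empty interval. *)
have comp0 v (g : #|v|.-tuple MR -> R) : ~~ (v \subset u) ->
    component (@anchored_kernel R) g x = 0.
  move=> /subsetPn[j jv ju]; rewrite componentE.
  under eq_Rintegral => t _.
    rewrite (bigD1 j)//= tnth_mktuple (negbTE ju) /anchored_kernel.
    rewrite set_itv_ge ?bnd_simp// indic0 mul0r mulr0.
    over.
  by rewrite Rintegral_cst// mul0r.
have := fE x x01; rewrite fE'// (bigD1 u)//= [in RHS](bigD1 u)//=.
have -> : \sum_(v | (0 < gam v) && (v != u)) component (@anchored_kernel R) (h v) x =
   \sum_(v | (0 < gam v) && (v != u)) component (@anchored_kernel R) (h' v) x.
  apply: eq_bigr => v /andP[gv vu].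
  have [vsu|vsu] := boolP (v \subset u); last by rewrite !comp0.
  have [mh _] := (Lfun_integralP _ p1 _).1 (hL v gv).
  have [mh' _] := (Lfun_integralP _ p1 _).1 (hL' v gv).
  apply: component_ae => //; try exact: measurable_anchored_kernel.
  apply: IH => //; apply: (@leq_trans #|u|); last by rewrite -ltnS.
  by apply: proper_card; rewrite finset.properEneq vu.
move=> /addIr; rewrite /component => hh.
have mprod : measurable_fun setT (fun t : #|u|.-tuple MR =>
    \prod_(i < #|u|) anchored_kernel (tnth y i) (tnth t i)).
  apply: measurable_prod => i _.
  exact: (measurableT_comp (measurable_anchored_kernel _) (measurable_tnth i)).
under eq_Rintegral do rewrite mulrBl.
rewrite RintegralB//.
- under eq_Rintegral do under eq_bigr do rewrite -xu.
  under [X in _ - X]eq_Rintegral do under eq_bigr do rewrite -xu.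
  by rewrite hh subrr.
- apply: integrable_mul_le1 => // t; apply: normr_prod_le1 => i _.
  exact: anchored_kernel_le1.
- apply: integrable_mul_le1 => // t; apply: normr_prod_le1 => i _.
  exact: anchored_kernel_le1.
Qed.

(** Downward induction on the cardinality of [v]: the converted component is [h v] plus terms from
    strict supersets, which agree almost everywhere by the induction hypothesis and cancel. *)
Lemma convert_inj_ae b h h' : measurable_fun setT b ->
  (forall u, 0 < gam u -> measurable_fun setT (h u)) ->
  (forall u, 0 < gam u -> measurable_fun setT (h' u)) ->
  (forall v, 0 < gam v -> ae_eq (cube #|v|) setT (convert b h v) (convert b h' v)) ->
  forall v, 0 < gam v -> ae_eq (cube #|v|) setT (h v) (h' v).
Proof.
move=> mb mh mh' hh' v; have [n] := ubnP (s - #|v|); elim: n v => // n IH v vn gv.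
(* There are finitely many [u], so a single null set serves them all. *)
have H : \forall t \ae cube #|v|, forall u : {set 'I_s}, v \proper u -> 0 < gam u ->
    partial_integral b u v (h u) t = partial_integral b u v (h' u) t.
  apply: filter_forall => u.
  have [vu|vu] := boolP (v \proper u); last by apply: filterE => t.
  have [gu|gu] := boolP (0 < gam u); last by apply: filterE => t.
  have : ae_eq (cube #|u|) setT (h u) (h' u).
    have uv := proper_card vu.
    apply: IH => //; apply: (@leq_trans (s - #|v|)); last by rewrite -ltnS.
    by rewrite ltn_sub2l// (leq_trans uv)// (leq_trans (max_card _))// card_ord.
  move=> /(@partial_integral_ae _ _ _ _ v _ _ mb (mh u gu) (mh' u gu)).
  by apply: filterS => t /(_ I) ->.
have := hh' v gv.
apply: filterS2 H => t Ht /(_ I) + _; rewrite /convert.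
rewrite (bigD1 v) ?subxx//= [in X in _ = X -> _](bigD1 v) ?subxx//= !partial_integral_id.
set S := \sum_(_ | _) _; set S' := \sum_(_ | _) _.
suff -> : S = S' by move=> /addIr.
apply: eq_bigr => u /andP[/andP[vu gu] uv]; apply: Ht => //.
by rewrite finset.properEneq eq_sym uv.
Qed.

End decompositions.
Arguments convert {R s}.

(** * Discrete Hoelder inequality and counting *)

Lemma sum_le_hoelder {R : realType} (I : Type) (r : seq I) (a : I -> R) (p q : R) :
  0 < p -> 0 < q -> p^-1 + q^-1 = 1 -> (forall i, 0 <= a i) ->
  \sum_(i <- r) a i <= (\sum_(i <- r) a i `^ p) `^ p^-1 * (size r)%:R `^ q^-1.
Proof.
move=> p0 q0 pq a0; elim: r => [|i r IH].
  by rewrite !big_nil mulr_ge0 ?powR_ge0.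
rewrite !big_cons.
set S := \sum_(j <- r) a j `^ p in IH *.
have S0 : 0 <= S by apply: sumr_ge0 => j _; exact: powR_ge0.
(* The two-term inequality is applied to $(a_i,S^{1/p})$ and $(1,n^{1/q})$, where $n$ is the length
   of [r]. *)
have := @hoelder2 R (a i) (S `^ p^-1) 1 ((size r)%:R `^ q^-1) p q (a0 i)
  (powR_ge0 _ _) ler01 (powR_ge0 _ _) p0 q0 pq.
rewrite mulr1 powR1 -!powRrM !mulVf ?gt_eqF// !powRr1// -natr1 [1 + _]addrC.
by apply: le_trans; rewrite lerD2l.
Qed.

Lemma normr_sum_powR {R : realType} (I : finType) (P : pred I) (a : I -> R) (p q : R) :
  0 < p -> 0 < q -> p^-1 + q^-1 = 1 ->
  `|\sum_(i | P i) a i| `^ p <= #|P|%:R `^ (p / q) * \sum_(i | P i) `|a i| `^ p.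
Proof.
move=> p0 q0 pq.
have S0 : 0 <= \sum_(i | P i) `|a i| `^ p by apply: sumr_ge0 => i _; exact: powR_ge0.
have := @sum_le_hoelder R I (enum P) (fun i => `|a i|) p q p0 q0 pq (fun=> normr_ge0 _).
rewrite !big_enum /= -cardE => H.
apply: (@le_trans _ _ ((\sum_(i in P) `|a i|) `^ p)).
  by apply: ge0_ler_powR; rewrite ?nnegrE ?sumr_ge0 ?(ltW p0)//; exact: ler_norm_sum.
apply: (@le_trans _ _ (((\sum_(i in P) `|a i| `^ p) `^ p^-1 * #|P|%:R `^ q^-1) `^ p)).
  apply: ge0_ler_powR; rewrite ?nnegrE ?mulr_ge0 ?powR_ge0 ?sumr_ge0 ?(ltW p0)//.
by rewrite powRM ?powR_ge0// -!powRrM mulVf ?gt_eqF// powRr1// mulrC [_ * p]mulrC.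
Qed.

(** A set of at most $q$ elements can be listed in $q$ slots, each holding an element or [None];
    there are $(s+1)^q$ ways to fill them. *)
Lemma card_subsets_le s q : (#|[pred u : {set 'I_s} | #|u| <= q]| <= s.+1 ^ q)%N.
Proof.
pose F (f : {ffun 'I_q -> option 'I_s}) : {set 'I_s} := [set i | Some i \in codom f]%SET.
rewrite -[leqRHS](_ : #|{ffun 'I_q -> option 'I_s}| = _)%N; last first.
  by rewrite card_ffun card_option !card_ord.
apply: leq_trans (leq_imset_card F predT); apply/subset_leq_card/fintype.subsetP => u.
rewrite inE => uq; apply/imsetP.
exists [ffun k : 'I_q => nth None (map Some (enum u)) k] => //.
apply/setP => i; rewrite inE; apply/idP/codomP => [iu|[k]].
  have ui : (index i (enum u) < #|u|)%N by rewrite cardE index_mem mem_enum.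
  exists (Ordinal (leq_trans ui uq)).
  by rewrite ffunE /= (nth_map i) -?cardE// nth_index// mem_enum.
rewrite ffunE; have [ku|uk] := ltnP k (size (enum u)).
  by rewrite (nth_map i)// => -[->]; rewrite -mem_enum mem_nth.
by rewrite nth_default// size_map.
Qed.

(** Each of the [m] factors of the falling factorial is at least [n - m]. *)
Lemma leq_exp_ffact n m : ((n - m) ^ m <= n ^_ m)%N.
Proof.
elim: m n => // m IH [|n]; first by rewrite sub0n exp0n.
rewrite ffactSS expnS leq_mul ?subSS ?leq_subr//.
  by rewrite (leq_trans (leq_subr _ _)).
Qed.

(** * Bounded versions of the kernels *)

Section kernels.
Context {R : realType}.
Implicit Types x t : R.

(* The cut-off outside of [0, 1[ keeps the kernels bounded by 1 on all of R, the
   carrier of the measure. *)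
Definition hat t : R := (1 - t) * \1_`[0, 1[%classic t.

Definition anova_kernel_bounded x t : R := anchored_kernel x t - hat t.

Lemma hat_ge0 t : 0 <= hat t.
Proof.
rewrite /hat indicE; case: (boolP (_ \in _)); rewrite ?mulr0// mulr1 inE/= in_itv/=.
by move=> /andP[_ /ltW]; rewrite subr_ge0.
Qed.

Lemma hatE t : 0 <= t < 1 -> hat t = 1 - t.
Proof. by move=> t01; rewrite /hat indicE mem_set ?mulr1//= in_itv. Qed.

Lemma hat_le1 t : `|hat t| <= 1.
Proof.
rewrite ger0_norm ?hat_ge0// /hat indicE.
case: (boolP (_ \in _)); rewrite ?mulr0 ?ler01// mulr1 inE/= in_itv/=.
by move=> /andP[t0 _]; rewrite gerBl.
Qed.

Lemma measurable_hat : measurable_fun setT hat.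
Proof. by apply: measurable_funM => //; apply: measurable_funB. Qed.

Lemma measurable_anova_kernel_bounded x : measurable_fun setT (anova_kernel_bounded x).
Proof.
by apply: measurable_funB; [exact: measurable_anchored_kernel|exact: measurable_hat].
Qed.

Lemma anova_kernel_bounded_le1 x t : `|anova_kernel_bounded x t| <= 1.
Proof.
have := hat_le1 t; rewrite ger0_norm ?hat_ge0// => h1; have := hat_ge0 t.
rewrite /anova_kernel_bounded /anchored_kernel indicE ler_norml.
by case: (_ \in _) => /= h0; apply/andP; split; lra.
Qed.

Lemma measurable_anova_kernel x : measurable_fun setT (anova_kernel x).
Proof.
apply: measurable_funB; first exact: measurable_indic.
exact: measurable_funB.
Qed.

Lemma anova_kernelE x t : 0 <= t < 1 -> anova_kernel x t = anova_kernel_bounded x t.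
Proof. by move=> t01; rewrite /anova_kernel_bounded hatE. Qed.

End kernels.

(** * Both norms computed from an anchored decomposition *)

Section norms.
Context {R : realType}.
Local Notation MR := (measurableTypeR R).
Local Notation cube := (@lebesgue_cube R).
Variables (s : nat) (gam : {set 'I_s} -> R) (p : R).
Hypothesis p1 : 1 < p.
Hypothesis gam_closed : forall u v : {set 'I_s}, v \subset u -> 0 < gam u -> 0 < gam v.
Implicit Types (u v : {set 'I_s}) (h g : @Defs.family R s) (f : s.-tuple R -> R).

Let p0 : 0 < p. Proof. exact: lt_trans p1. Qed.

(** Adding [hat] to [anova_kernel_bounded] gives exactly the anchored kernel, so [convert] applies;
    the bounded kernel is then exchanged for the ANOVA kernel, equal to it on $[0,1)$. *)
Lemma decomposition_anova f h : decomposition (@anchored_kernel R) gam p f h ->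
  decomposition (@anova_kernel R) gam p f (convert gam hat h).
Proof.
move=> fh; apply: (@eq_decomposition _ _ _ _ p1 anova_kernel_bounded).
- exact: measurable_anova_kernel_bounded.
- exact: measurable_anova_kernel.
- by move=> x t t01; rewrite anova_kernelE.
apply: decomposition_convert => //.
- exact: measurable_hat.
- exact: hat_le1.
- exact: measurable_anova_kernel_bounded.
- exact: anova_kernel_bounded_le1.
rewrite (_ : (fun _ _ => _) = @anchored_kernel R)//.
by apply/funext => x; apply/funext => t; rewrite subrK.
Qed.

(** Converting with [- hat] yields two anchored decompositions of the same [f], which agree almost
    everywhere, and the conversion is injective. *)
Lemma anova_unique f g g' : decomposition (@anova_kernel R) gam p f g ->
  decomposition (@anova_kernel R) gam p f g' ->
  forall u, 0 < gam u -> ae_eq (cube #|u|) setT (g u) (g' u).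
Proof.
have mNhat : measurable_fun setT (fun t : R => - hat t).
  by apply: measurableT_comp => //; exact: measurable_hat.
have conv g0 : decomposition (@anova_kernel R) gam p f g0 ->
    decomposition (@anchored_kernel R) gam p f (convert gam (fun t => - hat t) g0).
  move=> fg; apply: decomposition_convert => //.
  - by move=> t; rewrite normrN hat_le1.
  - exact: measurable_anchored_kernel.
  - exact: anchored_kernel_le1.
  apply: (@eq_decomposition _ _ _ _ p1 anova_kernel) => //.
  - exact: measurable_anova_kernel.
  - exact: measurable_anova_kernel_bounded.
  - by move=> x t t01; rewrite anova_kernelE.
move=> fg fg'; apply: (convert_inj_ae mNhat).
- by move=> u gu; have [] := (Lfun_integralP _ p1 _).1 (fg.1 u gu).
- by move=> u gu; have [] := (Lfun_integralP _ p1 _).1 (fg'.1 u gu).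
- by move=> v gv; apply: (anchored_unique p1 (conv _ fg) (conv _ fg')).
Qed.

Lemma weighted_normE h : weighted_norm gam p h =
  ((\sum_(u | (0 < gam u)%R) (gam u `^ (- p))%R%:E *
     \int[cube #|u|]_t (`|h u t| `^ p)%:E) `^ p^-1)%E.
Proof.
by congr (_ `^ _)%E; apply: eq_bigr => u _; rewrite Lnorm_poweRE.
Qed.

Lemma weighted_norm_ae h h' :
  (forall u, 0 < gam u -> measurable_fun setT (h u)) ->
  (forall u, 0 < gam u -> measurable_fun setT (h' u)) ->
  (forall u, 0 < gam u -> ae_eq (cube #|u|) setT (h u) (h' u)) ->
  weighted_norm gam p h = weighted_norm gam p h'.
Proof.
move=> mh mh' hh'; rewrite !weighted_normE; congr (_ `^ _)%E.
apply: eq_bigr => u gu; congr (_ * _)%E.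
have mpow (h0 : #|u|.-tuple MR -> R) : measurable_fun setT h0 ->
    measurable_fun setT (fun t => (`|h0 t| `^ p)%:E).
  move=> mh0; apply/measurable_EFinP/(measurableT_comp (measurable_powR p)).
  exact: measurableT_comp.
apply: ae_eq_integral => //; [exact: (mpow _ (mh u gu))|exact: (mpow _ (mh' u gu))|].
by have := hh' u gu; apply: filterS => t /(_ I) ->.
Qed.

(** [xget] returns an unspecified element of the set of norms; uniqueness almost everywhere makes
    that set a singleton. *)
Lemma space_normE k f h : decomposition k gam p f h ->
  (forall h', decomposition k gam p f h' ->
    forall u, 0 < gam u -> ae_eq (cube #|u|) setT (h' u) (h u)) ->
  space_norm k gam p f = weighted_norm gam p h.
Proof.
move=> fh uniq; rewrite /space_norm; case: xgetP => [N _ [h' fh' ->]|/(_ (weighted_norm gam p h))].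
  apply: weighted_norm_ae => [u gu|u gu|].
  - by have [] := (Lfun_integralP _ p1 _).1 (fh'.1 u gu).
  - by have [] := (Lfun_integralP _ p1 _).1 (fh.1 u gu).
  - exact: uniq.
by case; exists h.
Qed.

Lemma anchored_normE f h : decomposition (@anchored_kernel R) gam p f h ->
  anchored_norm gam p f = weighted_norm gam p h.
Proof.
by move=> fh; apply: space_normE => // h' fh'; exact: (anchored_unique p1 fh' fh).
Qed.

Lemma anova_normE f h : decomposition (@anchored_kernel R) gam p f h ->
  anova_norm gam p f = weighted_norm gam p (convert gam hat h).
Proof.
move=> /decomposition_anova fg; apply: space_normE => // g' fg'.
exact: (anova_unique fg' fg).
Qed.

Lemma anchored_spaceP f : anchored_space gam p f ->
  exists2 h, decomposition (@anchored_kernel R) gam p f h &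
    anchored_norm gam p f = weighted_norm gam p h.
Proof. by move=> [h fh]; exists h => //; exact: anchored_normE. Qed.

End norms.

(** * Upper bound *)

Section conditional_sums.
Context d (T : measurableType d) {R : realType} (I : finType) (P : pred I).

Lemma measurable_sum_cond (f : I -> T -> R) :
  (forall i, P i -> measurable_fun setT (f i)) ->
  measurable_fun setT (fun t => \sum_(i | P i) f i t).
Proof.
move=> mf.
rewrite (_ : (fun _ => _) = fun t => \sum_i (if P i then f i t else 0)); last first.
  by apply/funext => t; rewrite big_mkcond.
by apply: measurable_sum => i; case: (P i) (mf i) => [/(_ isT)|_].
Qed.

Lemma ge0_integral_sum_cond (m : {measure set T -> \bar R}) (f : I -> T -> \bar R) :
  (forall i, P i -> measurable_fun setT (f i)) ->
  (forall i t, P i -> 0 <= f i t)%E ->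
  (\int[m]_t (\sum_(i | P i) f i t) = \sum_(i | P i) \int[m]_t f i t)%E.
Proof.
move=> mf f0.
transitivity (\int[m]_t \sum_i (if P i then f i t else 0))%E.
  by apply: eq_integral => t _; rewrite big_mkcond.
rewrite ge0_integral_sum//.
- rewrite [RHS]big_mkcond; apply: eq_bigr => i _; case: ifPn => // _.
  exact: integral0.
- by move=> i; case: (P i) (mf i) => [/(_ isT)|_].
- by move=> i t _; case: ifPn => // /f0.
Qed.

End conditional_sums.

Section upper_bound.
Context {R : realType}.
Local Notation MR := (measurableTypeR R).
Local Notation cube := (@lebesgue_cube R).
Variables (s : nat) (gam : {set 'I_s} -> R) (p pstar : R).
Hypotheses (p1 : 1 < p) (pp : p^-1 + pstar^-1 = 1).

Let p0 : 0 < p. Proof. exact: lt_trans p1. Qed.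

Lemma conjugate_gt0 : 0 < pstar.
Proof.
rewrite -invr_gt0 (_ : pstar^-1 = 1 - p^-1); first by rewrite subr_gt0 invf_lt1.
by rewrite -pp addrC addKr.
Qed.

(** Hoelder's inequality for the sum over [u] produces the power of [N], and Jensen's inequality
    bounds each summand. *)
Lemma integral_convert_le (h : @Defs.family R s) (v : {set 'I_s}) (N : nat) :
  (forall u, 0 < gam u -> h u \in Lfun (cube #|u|) p%:E) ->
  (#|[pred u | (0 < gam u)%R]| <= N)%N ->
  (\int[cube #|v|]_t (`|convert gam hat h v t| `^ p)%:E <=
   (N%:R `^ (p / pstar))%:E * \sum_(u : {set 'I_s} | (v \subset u) && (0 < gam u)%R)
      \int[cube #|u|]_t (`|h u t| `^ p)%:E)%E.
Proof.
move=> hL NP; pose P (u : {set 'I_s}) := (v \subset u) && (0 < gam u).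
have hi u : 0 < gam u -> (cube #|u|).-integrable setT (EFin \o h u).
  by move=> gu; exact: Lfun_integrable1 p1 (hL u gu).
have mpi u : P u -> measurable_fun setT (partial_integral hat u v (h u)).
  move=> /andP[vu gu]; apply: measurable_partial_integral => //.
  - exact: measurable_hat.
  - exact: hat_le1.
  - exact: hi.
have mpow u : P u -> measurable_fun setT (fun t => (`|partial_integral hat u v (h u) t| `^ p)%:E).
  move=> Pu; apply/measurable_EFinP/(measurableT_comp (measurable_powR p)).
  by apply: measurableT_comp => //; exact: mpi.
have mS : measurable_fun setT (fun t => (\sum_(u | P u) (`|partial_integral hat u v (h u) t| `^ p)%:E)%E).
  under eq_fun do rewrite sumEFin.
  by apply/measurable_EFinP/measurable_sum_cond => u Pu; have /measurable_EFinP := mpow u Pu.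
have PN : (#|P| <= N)%N.
  apply: leq_trans NP; apply/subset_leq_card/fintype.subsetP => u.
  by rewrite !inE => /andP[].
apply: (@le_trans _ _ (\int[cube #|v|]_t ((N%:R `^ (p / pstar))%:E *
    \sum_(u | P u) (`|partial_integral hat u v (h u) t| `^ p)%:E))%E).
  apply: ge0_le_integral => //.
  - apply/measurable_EFinP/(measurableT_comp (measurable_powR p)).
    by apply: measurableT_comp => //; apply: measurable_sum_cond.
  - exact: emeasurable_funM.
  - move=> t _; rewrite sumEFin -EFinM lee_fin.
    apply: le_trans (normr_sum_powR _ _ p0 conjugate_gt0 pp) _.
    apply: ler_wpM2r; first by apply: sumr_ge0 => u _; exact: powR_ge0.
    by rewrite ge0_ler_powR ?nnegrE ?ler_nat// divr_ge0 ?(ltW p0) ?(ltW conjugate_gt0).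
rewrite ge0_integralZl//; last first.
  by move=> t _; rewrite sume_ge0// => u _; rewrite lee_fin powR_ge0.
rewrite ge0_integral_sum_cond//.
apply: lee_wpmul2l; first by rewrite lee_fin powR_ge0.
apply: lee_sum => u /andP[vu gu].
exact: (integral_poweR_partial_integral measurable_hat hat_le1 v (hi u gu) p0 conjugate_gt0 pp).
Qed.

(** After the sums are exchanged, each integral of $|h_u|^p$ is counted for at most [L] subsets [v]
    of [u], each time at the cost of a weight ratio bounded by [K]. *)
Lemma weighted_norm_convert_le (h : @Defs.family R s) (N L : nat) (K : R) :
  0 <= K ->
  (forall u, 0 < gam u -> h u \in Lfun (cube #|u|) p%:E) ->
  (#|[pred u | (0 < gam u)%R]| <= N)%N ->
  (forall u, (0 < gam u)%R -> 2 ^ #|u| <= L)%N ->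
  (forall u v : {set 'I_s}, v \subset u -> 0 < gam u ->
    gam v `^ (- p) <= K * gam u `^ (- p)) ->
  (weighted_norm gam p h <= 1)%E ->
  (weighted_norm gam p (convert gam hat h) <=
    (N%:R `^ pstar^-1 * (L%:R * K) `^ p^-1)%:E)%E.
Proof.
move=> K0 hL NP LP KP.
pose J (u : {set 'I_s}) := fine (\int[cube #|u|]_t (`|h u t| `^ p)%:E)%E.
have J0 u : 0 <= J u by apply/fine_ge0/integral_ge0 => t _; rewrite lee_fin powR_ge0.
have JE u : 0 < gam u -> (\int[cube #|u|]_t (`|h u t| `^ p)%:E = (J u)%:E)%E.
  move=> gu; rewrite fineK// ge0_fin_numE.
    by have [] := (Lfun_integralP _ p1 _).1 (hL u gu).
  by apply: integral_ge0 => t _; rewrite lee_fin powR_ge0.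
have gp0 (u : {set 'I_s}) : 0 <= gam u `^ (- p) by exact: powR_ge0.
pose W := \sum_(u | 0 < gam u) gam u `^ (- p) * J u.
have W0 : 0 <= W by apply: sumr_ge0 => u _; rewrite mulr_ge0.
have -> : weighted_norm gam p h = (W `^ p^-1)%:E.
  rewrite weighted_normE// -poweR_EFin; congr (_ `^ _)%E.
  by rewrite -sumEFin; apply: eq_bigr => u gu; rewrite JE.
rewrite lee_fin => W1.
have {}W1 : W <= 1.
  have : (W `^ p^-1) `^ p <= 1 `^ p.
    by apply: ge0_ler_powR; rewrite ?nnegrE ?powR_ge0 ?(ltW p0).
  by rewrite -powRrM mulVf ?gt_eqF// powRr1// powR1.
set B := N%:R `^ (p / pstar).
have B0 : 0 <= B by exact: powR_ge0.
have key : (\sum_(v | (0 < gam v)%R) (gam v `^ (- p))%R%:E *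
     \int[cube #|v|]_t (`|convert gam hat h v t| `^ p)%:E <= (B * (L%:R * K))%:E)%E.
  apply: (@le_trans _ _ (\sum_(v | (0 < gam v)%R) (gam v `^ (- p) *
      (B * \sum_(u : {set 'I_s} | (v \subset u) && (0 < gam u)) J u))%:E)%E).
    apply: lee_sum => v gv; rewrite EFinM; apply: lee_wpmul2l; first by rewrite lee_fin.
    apply: le_trans (integral_convert_le v hL NP) _.
    rewrite EFinM; apply: lee_wpmul2l; first by rewrite lee_fin.
    rewrite -sumEFin.
    by apply: lee_sum => u /andP[_ gu]; rewrite JE.
  rewrite sumEFin lee_fin.
  under eq_bigr do rewrite mulrCA mulr_sumr.
  rewrite -mulr_sumr ler_wpM2l//.
  rewrite (exchange_big_dep (fun u => 0 < gam u)) /=; last by move=> v u _ /andP[].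
  apply: (@le_trans _ _ (\sum_(u | 0 < gam u) L%:R * K * (gam u `^ (- p) * J u))).
    apply: ler_sum => u gu; rewrite -mulr_suml [leRHS]mulrA ler_wpM2r//.
    (* The sum is enlarged to all subsets of [u], of which there are [2 ^ #|u|]. *)
    apply: (@le_trans _ _ (\sum_(v : {set 'I_s} | v \subset u) K * gam u `^ (- p))).
      rewrite [leRHS](bigID (fun v => 0 < gam v)) /= [leRHS]addrC -[leLHS]add0r lerD//.
        by apply: sumr_ge0 => v _; rewrite mulr_ge0 .
      rewrite (eq_bigl (fun v : {set 'I_s} => (v \subset u) && (0 < gam v))); last first.
        by move=> v; rewrite gu andbT andbC.
      by apply: ler_sum => v /andP[vu _]; exact: KP.
    rewrite sumr_const -[leLHS]mulr_natl -mulrA ler_wpM2r ?mulr_ge0 // ler_nat.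
    rewrite (_ : #|_| = #|powerset u|)%N ?card_powerset ?LP//.
    by rewrite -card_powerset; apply: eq_card => v; rewrite powersetE.
  rewrite -mulr_sumr -/W.
  by rewrite ler_piMr// mulr_ge0.
rewrite weighted_normE//.
apply: (@le_trans _ _ ((B * (L%:R * K))%:E `^ p^-1)%E).
  apply: gt0_ler_poweR => //; rewrite ?invr_ge0 ?(ltW p0) ?in_itv/= ?leey ?andbT//.
  - apply: sume_ge0 => v _; rewrite mule_ge0 ?lee_fin//.
    by apply: integral_ge0 => t _; rewrite lee_fin powR_ge0.
  - by rewrite lee_fin !mulr_ge0.
rewrite poweR_EFin lee_fin powRM ?mulr_ge0// /B -powRrM mulrAC divff ?gt_eqF// mul1r.
by [].
Qed.

End upper_bound.

(** * Lower bound *)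

Section lower_bound.
Context {R : realType}.
Local Notation MR := (measurableTypeR R).
Local Notation cube := (@lebesgue_cube R).
Variable s : nat.
Implicit Types u v : {set 'I_s}.

Lemma integrable_prod_hat u :
  (cube s).-integrable setT (EFin \o (fun y => \prod_(j in u) hat (tnth y j))).
Proof.
rewrite (_ : (fun _ => _) = (fun y => 1 * \prod_(j in u) hat (tnth y j))).
  apply: integrable_mul_le1.
  - exact: finite_measure_integrable_cst.
  - by apply: measurable_prod_in => j; exact: (measurableT_comp measurable_hat (measurable_tnth j)).
  - by move=> y; apply: normr_prod_le1 => j _; exact: hat_le1.
by apply/funext => y; rewrite mul1r.
Qed.

(* On the part of the cube where [y_j < 1/2] for all [j] in [u] each factor is
   at least [1/2], and this part has measure [2^-|u|]. *)
Lemma Rintegral_prod_hat_ge u :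
  4^-1 ^+ #|u| <= \int[cube s]_y \prod_(j in u) hat (tnth y j).
Proof.
pose A (j : 'I_s) : set MR := if j \in u then `[0, 2^-1[%classic else setT.
have mA j : measurable (A j).
  by rewrite /A; case: ifP => _; [exact: measurable_itv|exact: measurableT].
have muA : (cube s (box A) = (2^-1 ^+ #|u|)%:E)%E.
  rewrite lebesgue_cube_box//.
  transitivity (\prod_(j < s) (if j \in u then 2^-1 else 1 : R)%:E)%E.
    apply: eq_bigr => j _; rewrite /A; case: ifP => _; last exact: probability_setT.
    by rewrite lebesgue01_itvco//; lra.
  by rewrite prodEFin -big_mkcond prodr_const.
have mB := measurable_box mA.
have -> : 4^-1 ^+ #|u| = \int[cube s]_y (2^-1 ^+ #|u| * \1_(box A) y).
  rewrite RintegralZl//; last exact: integrable_indic.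
  have -> : \int[cube s]_y \1_(box A) y = 2^-1 ^+ #|u|.
    by rewrite /Rintegral integral_indic// setIT; exact: (congr1 fine muA).
  by rewrite -exprMn -invfM -natrM.
apply: le_Rintegral => //.
- rewrite (_ : _ \o _ = fun y => (2^-1 ^+ #|u|)%:E * (EFin \o \1_(box A)) y)%E.
    by apply: integrableZl => //; exact: integrable_indic.
  by apply/funext => y; rewrite /= EFinM.
- exact: integrable_prod_hat.
move=> y _; rewrite indicE; case: (boolP (_ \in _)) => [/set_mem yA|_].
  rewrite mulr1 -prodr_const; apply: ler_prod => j ju.
  have := yA j; rewrite /A ju /= in_itv/= => /andP[y0 y1].
  by rewrite hatE; lra.
by rewrite mulr0; apply: prodr_ge0 => j _; exact: hat_ge0.
Qed.

Lemma partial_integral_cst_ge u (c : R) t : 0 <= c ->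
  c * 4^-1 ^+ #|u| <= partial_integral hat u finset.set0 (cst c) t.
Proof.
move=> c0; rewrite /partial_integral finset.setD0 /=.
rewrite RintegralZl//; last exact: integrable_prod_hat.
by rewrite ler_wpM2l//; exact: Rintegral_prod_hat_ge.
Qed.

(** The single component at [v] already gives the bound, since its weight and the mass of the cube
    are both 1. *)
Lemma le_weighted_norm (gam : {set 'I_s} -> R) (p c : R) (g : @Defs.family R s) v :
  1 < p -> gam v = 1%R -> 0 <= c -> measurable_fun setT (g v) ->
  (forall t, c <= g v t) -> (c%:E <= weighted_norm gam p g)%E.
Proof.
move=> p1 gv c0 mg cg; have p0 : 0 < p by exact: lt_trans p1.
rewrite weighted_normE// (bigD1 v)/= ?gv//.
have S0 u : (0 <= \int[cube #|u|]_t (`|g u t| `^ p)%:E)%E.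
  by apply: integral_ge0 => t _; rewrite lee_fin powR_ge0.
have cp : ((c `^ p)%:E <= \int[cube #|v|]_t (`|g v t| `^ p)%:E)%E.
  have -> : ((c `^ p)%:E = \int[cube #|v|]_t cst (c `^ p)%:E t)%E.
    by rewrite integral_cst// -[LHS]mule1; congr (_ * _)%E; exact/esym/probability_setT.
  apply: ge0_le_integral => //.
  - by move=> t _; rewrite lee_fin powR_ge0.
  - apply/measurable_EFinP/(measurableT_comp (measurable_powR p)).
    exact: measurableT_comp.
  - move=> t _; rewrite lee_fin ge0_ler_powR ?nnegrE ?(ltW p0)//.
    exact: le_trans (cg t) (ler_norm _).
have cE : c = (c `^ p) `^ p^-1 by rewrite -powRrM mulfV ?lt0r_neq0// powRr1.
rewrite {1}cE -poweR_EFin.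
apply: gt0_ler_poweR; rewrite ?invr_ge0 ?(ltW p0) ?in_itv/= ?leey ?andbT ?lee_fin ?powR_ge0//.
  by rewrite adde_ge0 ?mule_ge0 ?lee_fin ?powR_ge0// sume_ge0// => u _; rewrite mule_ge0 ?lee_fin ?powR_ge0.
rewrite powR1 mul1e; apply: le_trans cp _; rewrite leeDl// sume_ge0// => u _.
by rewrite mule_ge0 ?lee_fin ?powR_ge0.
Qed.

End lower_bound.

(** * Finite order weights *)

Section finite_order_weights.
Context {R : realType}.
Local Notation MR := (measurableTypeR R).
Local Notation cube := (@lebesgue_cube R).
Variables (p pstar omega : R) (q : nat).
Hypotheses (p1 : 1 < p) (pp : p^-1 + pstar^-1 = 1) (w0 : 0 < omega).
Local Notation gam := (finite_order_weight omega q).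

Let p0 : 0 < p. Proof. exact: lt_trans p1. Qed.
Let ps0 : 0 < pstar. Proof. exact: conjugate_gt0 p1 pp. Qed.

Lemma finite_order_weight_gt0 s (u : {set 'I_s}) : (0 < gam u) = (#|u| <= q)%N.
Proof.
by rewrite /finite_order_weight; case: ifP; rewrite ?ltxx// exprn_gt0.
Qed.

Lemma finite_order_weight_closed s (u v : {set 'I_s}) :
  v \subset u -> 0 < gam u -> 0 < gam v.
Proof.
by rewrite !finite_order_weight_gt0 => /subset_leq_card; exact: leq_trans.
Qed.

(** The ratio $\gamma_u/\gamma_v$ is $\omega^{|u|-|v|}$ with exponent between 0 and $q$; the maximum
    with 1 covers both small and large $\omega$. *)
Lemma finite_order_weight_ratio s (u v : {set 'I_s}) : v \subset u -> 0 < gam u ->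
  gam v `^ (- p) <= (Num.max 1 omega ^+ q) `^ p * gam u `^ (- p).
Proof.
move=> vu gu; have gv := finite_order_weight_closed vu gu.
rewrite !powRN; set M := Num.max 1 omega.
have M1 : 1 <= M by rewrite le_max lexx.
rewrite ler_pdivlMr ?powR_gt0// mulrC ler_pdivrMr ?powR_gt0//.
rewrite -powRM ?exprn_ge0 ?(ltW gv)// ?(le_trans ler01)//.
apply: ge0_ler_powR; rewrite ?nnegrE ?mulr_ge0 ?exprn_ge0 ?(ltW gv) ?(ltW gu) ?(ltW p0) ?(le_trans ler01)//.
move: gu gv; rewrite !finite_order_weight_gt0 /finite_order_weight => uq vq.
rewrite uq vq -(subnK (subset_leq_card vu)) exprD ler_wpM2r ?exprn_ge0 ?(ltW w0)//.
apply: (@le_trans _ _ (M ^+ (#|u| - #|v|))).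
  by rewrite lerXn2r ?nnegrE ?(ltW w0) ?(le_trans ler01)// le_max lexx orbT.
by rewrite ler_weXn2l// (leq_trans (leq_subr _ _)).
Qed.

Lemma embedding_norm_le s : (0 < s)%N ->
  (embedding_norm (@finite_order_weight R omega q s) p <=
   ((2 ^+ q) `^ pstar^-1 *
     ((2 ^ q)%:R * (Num.max 1 omega ^+ q) `^ p) `^ p^-1 *
     s%:R `^ (q%:R / pstar))%:E)%E.
Proof.
move=> s0; apply: ge_ereal_sup => _ [f [/(anchored_spaceP p1)[h fh fhE] f1] <-].
rewrite (anova_normE p1 (@finite_order_weight_closed s) fh).
(* [N] bounds the number of sets of size at most $q$, [L] the number of subsets of any one of them,
   and [K] the weight ratios. *)
apply: le_trans (weighted_norm_convert_le (N := s.+1 ^ q) (L := 2 ^ q)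
  (K := (Num.max 1 omega ^+ q) `^ p) p1 pp _ fh.1 _ _ _ _) _.
- exact: powR_ge0.
- apply: leq_trans (card_subsets_le s q).
  apply/subset_leq_card/fintype.subsetP => u.
  by rewrite !inE finite_order_weight_gt0.
- move=> u; rewrite finite_order_weight_gt0 => uq.
  exact: (leq_pexp2l (n2 := q) _ uq).
- exact: finite_order_weight_ratio.
- by rewrite -fhE.
rewrite lee_fin [leRHS]mulrAC ler_wpM2r ?powR_ge0//.
rewrite powRrM powR_mulrn ?ler0n// -powRM ?exprn_ge0//.
apply: ge0_ler_powR; rewrite ?nnegrE ?invr_ge0 ?(ltW ps0)//.
(* Positivity of [s] gives $s+1\le 2s$. *)
by rewrite -exprMn -natrM natrX lerXn2r ?nnegrE ?ler0n// ler_nat mul2n -addnn -add1n leq_add2r.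
Qed.

Lemma embedding_norm_ge s : (2 * q <= s)%N ->
  (((4^-1 * omega) ^+ q * ((2 ^+ q * (q`!)%:R)^-1) `^ pstar^-1 *
     s%:R `^ (q%:R / pstar))%:E <=
   embedding_norm (@finite_order_weight R omega q s) p)%E.
Proof.
move=> qs; pose wt := @finite_order_weight R omega q s.
have qs' : (q <= s)%N by rewrite (leq_trans _ qs)// mul2n -addnn leq_addr.
pose C : R := 'C(s, q)%:R.
have C0 : 0 < C by rewrite ltr0n bin_gt0.
(* [a] normalises the anchored norm to 1: each of the [C] sets of size $q$ contributes
   $\omega^{-pq}a^p=1/C$. *)
pose a := omega ^+ q * C `^ (- p^-1).
have a0 : 0 <= a by rewrite mulr_ge0 ?powR_ge0// exprn_ge0 ?ltW.
pose h : @Defs.family R s := fun u => if #|u| == q then cst a else cst 0.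
have sumq (x : R) : \sum_(u : {set 'I_s} | 0 < wt u) (if #|u| == q then x else 0) = C * x.
  rewrite -big_mkcondr /= (eq_bigl (fun u : {set 'I_s} => u \in [set u : {set 'I_s} | #|u| == q]%SET)).
    by rewrite sumr_const card_draws card_ord mulr_natl.
  move=> u; rewrite inE /wt finite_order_weight_gt0.
  by case: eqP => [->|]; rewrite ?leqnn ?andbF.
pose f (x : s.-tuple R) := \sum_(u : {set 'I_s} | 0 < wt u) component (@anchored_kernel R) (h u) x.
have fh : decomposition (@anchored_kernel R) wt p f h.
  split=> // u _; rewrite /h; case: ifP => _; exact: Lfun_cst.
have h1 : (weighted_norm wt p h = 1)%E.
  rewrite weighted_normE//.
  have -> : (\sum_(u : {set 'I_s} | (0 < wt u)%R) (wt u `^ (- p))%R%:E *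
     \int[cube #|u|]_t (`|h u t| `^ p)%:E = 1)%E.
    transitivity (\sum_(u : {set 'I_s} | (0 < wt u)%R)
        (if #|u| == q then (omega ^+ q) `^ (- p) * a `^ p else 0)%:E)%E.
      apply: eq_bigr => u gu.
      have hu t : `|h u t| `^ p = if #|u| == q then a `^ p else 0.
        rewrite /h; case: ifP => _; first by rewrite ger0_norm.
        by rewrite normr0 powR0 ?gt_eqF.
      under eq_integral do rewrite hu.
      rewrite integral_cst//.
      rewrite [X in (_ * (_ * X))%E](probability_setT (cube #|u|)) mule1 -EFinM.
      congr EFin; case: eqP => [uq|_]; last by rewrite mulr0.
      by rewrite /wt /finite_order_weight uq leqnn.
    rewrite sumEFin sumq /a powRM ?powR_ge0// ?exprn_ge0 ?ltW//.
    rewrite -powRrM mulNr mulVf ?gt_eqF// !powRN powRr1 ?ltW//.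
    by rewrite mulKf ?gt_eqF ?powR_gt0 ?exprn_gt0// mulfV ?gt_eqF.
  exact: poweR1r.
have fnorm := anchored_normE p1 fh.
apply: (@le_trans _ _ (anova_norm wt p f)); last first.
  apply: ereal_sup_ubound; exists f => //; split; first by exists h.
  by rewrite fnorm h1.
rewrite (anova_normE p1 (@finite_order_weight_closed s) fh).
have hi u : 0 < wt u -> (cube #|u|).-integrable setT (EFin \o h u).
  by move=> gu; exact: Lfun_integrable1 p1 (fh.1 u gu).
(* The component at the empty set has weight $\omega^0=1$. *)
apply: (@le_weighted_norm _ _ _ _ _ _ finset.set0 p1).
- by rewrite /finite_order_weight cards0.
- by rewrite !mulr_ge0 ?powR_ge0// exprn_ge0// mulr_ge0// ltW.
- have fg := decomposition_anova p1 (@finite_order_weight_closed s) fh.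
  have w1 : 0 < wt finset.set0 by rewrite finite_order_weight_gt0 cards0.
  by have [] := (Lfun_integralP _ p1 _).1 (fg.1 _ w1).
move=> t; apply: (@le_trans _ _ (C * (a * 4^-1 ^+ q))).
  have -> : C * (a * 4^-1 ^+ q) = (4^-1 * omega) ^+ q * C `^ pstar^-1.
    have -> : C `^ pstar^-1 = C * C `^ (- p^-1).
      rewrite -{2}[C]powRr1 ?ltW// -powRD ?(gt_eqF C0) ?implybT//.
      by congr (_ `^ _); rewrite -pp addrC addKr.
    by rewrite /a exprMn; ring.
  rewrite -mulrA ler_wpM2l ?exprn_ge0 ?mulr_ge0 ?(ltW w0)//.
  rewrite powRrM powR_mulrn ?ler0n// -powRM ?invr_ge0 ?mulr_ge0 ?exprn_ge0//.
  apply: ge0_ler_powR; rewrite ?nnegrE ?invr_ge0 ?mulr_ge0 ?invr_ge0 ?mulr_ge0 ?exprn_ge0 ?(ltW ps0) ?(ltW C0)//.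
  rewrite mulrC ler_pdivrMr ?mulr_gt0 ?exprn_gt0 ?ltr0n ?fact_gt0//.
  rewrite -!natrX -!natrM ler_nat mulnCA bin_ffact.
  (* From $2q\le s$ comes $s\le 2(s-q)$, hence $s^q\le 2^q(s-q)^q\le 2^q\,q!\binom{s}{q}$. *)
  apply: (@leq_trans (2 ^ q * (s - q) ^ q)); last by rewrite leq_mul2l leq_exp_ffact orbT.
  rewrite -expnMn; case: (posnP q) => [->//|q0]; rewrite leq_exp2r//.
  by rewrite mulnBr leq_subRL ?leq_mul2l// [X in (_ <= X)%N]mul2n -addnn leq_add2r.
(* The component at the empty set sums the partial integrals over all [u]: sets of size $q$ give at
   least $a\,4^{-q}$ each, the others at least 0. *)
rewrite -sumq /convert big_mkcond [leRHS]big_mkcond /=.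
apply: ler_sum => u _; rewrite finset.sub0set /=; case: ifPn => // gu.
rewrite /h; case: ifPn => [/eqP uq|_].
  by rewrite -[in leLHS]uq; exact: (partial_integral_cst_ge u t a0).
by have := partial_integral_cst_ge u t (lexx 0); rewrite mul0r.
Qed.

End finite_order_weights.

(** * The two-sided bound with explicit constants *)

Theorem proposition6 (R : realType) (p pstar : R) (hp : 1 < p)
  (hpstar : p^-1 + pstar^-1 = 1) (omega : R) (homega : 0 < omega)
  (q : nat) (hq : (1 <= q)%N) :
  is_Theta
    (fun s : nat => embedding_norm (@finite_order_weight R omega q s) p)
    (fun s : nat => s%:R `^ (q%:R / pstar)).
Proof.
pose c1 := (4^-1 * omega) ^+ q * ((2 ^+ q * (q`!)%:R)^-1) `^ pstar^-1.
pose c2 := (2 ^+ q) `^ pstar^-1 * ((2 ^ q)%:R * (Num.max 1 omega ^+ q) `^ p) `^ p^-1.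
(* The maximum makes the order of the two constants immediate and only weakens the upper bound. *)
exists c1, (Num.max c1 c2); split.
- apply: mulr_gt0; first by rewrite exprn_gt0// mulr_gt0.
  by rewrite powR_gt0// invr_gt0 mulr_gt0 ?exprn_gt0// ltr0n fact_gt0.
- by rewrite le_max lexx.
(* The lower bound holds from $2q$ on, and there $s$ is positive because $q\ge1$, as the upper bound
   requires. *)
exists (2 * q)%N => // s /= qs; apply/andP; split.
  exact: embedding_norm_ge.
apply: (@le_trans _ _ (c2 * s%:R `^ (q%:R / pstar))%:E).
  by apply: embedding_norm_le => //; apply: leq_trans qs; rewrite muln_gt0.
by rewrite lee_fin ler_wpM2r ?powR_ge0// le_max lexx orbT.
Qed.
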